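(* For all integers $n,m\geq 2$ and $1\leq r\leq m$, the maximum forcing number of the quadriculated torus $T(2n,2m,2r)$ is $$F(T(2n,2m,2r))=\begin{cases} mn+1, & \text{if } (r,m)=1;\\ mn, & \text{otherwise},\end{cases}$$ where $(r,m)$ denotes the greatest common divisor of $r$ and $m$.
   Context: Quadriculated torus: for integers $p\ge 2$, $q\ge 3$ and $1\le s\le q$, the quadriculated torus $T(p,q,s)$ is the graph obtained from a $p\times q$ chessboard ($p$ rows, each consisting of $q$ squares) by sticking the left and right sides together and then identifying the top and bottom sides with a torsion of $s$ squares. Explicitly, $T(p,q,s)$ is the simple graph with vertex set $\{v_{i,j} : i\in\{0,\dots,p-1\},\ j\in \mathbb{Z}/q\mathbb{Z}\}$, whose edges are: $v_{i,j}v_{i,j+1}$ for all $i,j$ (second index modulo $q$); $v_{i,j}v_{i+1,j}$ for $0\le i\le p-2$ and all $j$; and $v_{0,j}v_{p-1,j-s}$ for all $j$ (second index modulo $q$). Forcing numbers: let $G$ be a finite graph with a perfect matching $M$. A subset $S\subseteq M$ is a forcing set of $M$ if $S$ is contained in no perfect matching of $G$ other than $M$. The forcing number $f(G,M)$ is the smallest cardinality of a forcing set of $M$. The maximum forcing number $F(G)$ is the maximum of $f(G,M)$ over all perfect matchings $M$ of $G$. *)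

(* Defs.v *)
From mathcomp Require Import all_boot.

Set Implicit Arguments.
Unset Strict Implicit.
Unset Printing Implicit Defensive.

(* A simple graph on T is given by its adjacency relation, a symmetric and
   irreflexive relation; an edge is the set of its two ends. *)
Section Matchings.

Variables (T : finType) (adj : rel T).

Definition edges : {set {set T}} :=
  [set [set e.1; e.2] | e in [pred e : T * T | adj e.1 e.2]].

Definition perfect_matching (M : {set {set T}}) : bool :=
  (M \subset edges) && [forall v, #|[set E in M | v \in E]| == 1].

Definition forcing_set (M S : {set {set T}}) : bool :=
  (S \subset M) &&
  [forall N : {set {set T}}, perfect_matching N && (S \subset N) ==> (N == M)].

(* The search starts from M itself, which is a forcing set whenever M is a
   perfect matching (forcing_set_id), so that this is a genuine minimum. *)
Definition forcing_number (M : {set {set T}}) : nat :=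
  #|[arg min_(S < M | forcing_set M S) #|S|]|.

(* The value is 0 if there is no perfect matching. *)
Definition max_forcing_number : nat :=
  \max_(M : {set {set T}} | perfect_matching M) forcing_number M.

Lemma perfect_matching_sub_eq (M N : {set {set T}}) :
  perfect_matching M -> perfect_matching N -> M \subset N -> N = M.
Proof.
move=> /andP[_ /forallP pM] /andP[/subsetP sN /forallP pN] sMN.
apply/eqP; rewrite eqEsubset sMN andbT; apply/subsetP=> E EN.
have /imsetP[e _ defE] := sN _ EN.
have e1E : e.1 \in E by rewrite defE !inE eqxx.
have /cards1P[F defF] := pM e.1; have /cards1P[G defG] := pN e.1.
have: F \in [set F] by rewrite inE.
rewrite -defF inE => /andP[FM e1F].
have: F \in [set G] by rewrite -defG inE (subsetP sMN _ FM).
have: E \in [set G] by rewrite -defG inE EN.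
by rewrite !inE => /eqP-> /eqP<-.
Qed.

Lemma forcing_set_id (M : {set {set T}}) :
  perfect_matching M -> forcing_set M M.
Proof.
move=> pM; rewrite /forcing_set subxx; apply/forallP=> N.
by apply/implyP=> /andP[pN /(perfect_matching_sub_eq pM pN) ->].
Qed.

End Matchings.

Section Torus.

Variables p q s : nat.

(* The pair (i, j) stands for v_{i,j}; the second index is read modulo q. *)
Definition torus_vertex : finType := ('I_p * 'I_q)%type.

(* In the last disjunct y = v_{p-1,k} with k = j - s modulo q, where
   x = v_{0,j}; this is written j = k + s to avoid truncated subtraction. *)
Definition torus_edge (x y : torus_vertex) : bool :=
  [|| (x.1 == y.1) && (y.2 == x.2 + 1 %[mod q]),
      (y.1 == x.1.+1 :> nat) && (x.2 == y.2)
    | [&& x.1 == 0 :> nat, y.1 == p.-1 :> nat & x.2 == y.2 + s %[mod q]]].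

Definition torus_adj : rel torus_vertex :=
  fun x y => torus_edge x y || torus_edge y x.

Lemma torus_adj_sym : symmetric torus_adj.
Proof. by move=> x y; rewrite /torus_adj orbC. Qed.

Lemma torus_adj_irrefl : 2 <= p -> 3 <= q -> irreflexive torus_adj.
Proof.
move=> p2 q3 [i j]; rewrite /torus_adj orbb /torus_edge /= eqxx /=.
rewrite -{1}[nat_of_ord j]addn0 eqn_modDl mod0n modn_small ?(ltn_trans _ q3) //.
have -> /= : (i == i.+1 :> nat) = false by apply/ltn_eqF.
have [-> /=|//] := eqVneq (i : nat) 0.
by have -> : (0 == p.-1) = false by case: (p) p2 => [|[|]].
Qed.

End Torus.

Arguments torus_edge : clear implicits.
Arguments torus_adj : clear implicits.

(* Main.v *)
Require Import Defs.
From mathcomp Require Import all_boot.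
From mathcomp Require Import ssralg ssrnum ssrint zify.

(** The torus is the quotient of the square grid by a lattice, with the commuting
translations a (down) and b (right).

Upper bounds.  Let A be a set of vertices without adjacent or diagonally adjacent
pairs.  If the edges of a perfect matching M at A do not leave a forcing set,
then A contains a circuit: a closed walk which repeatedly goes straight across
the M-edge at the current vertex, so that it stays inside one class of vertices
modulo 2.  The flow of a circuit is divergence free; integrating it along
vertical rays gives a height function on the opposite class, and by induction a
circuit that avoids a row has nonzero height past its last row, that is, it
winds around the torus horizontally.  With e = gcd(2r, 2m) the columns modulo e
form a second grid, where a and b are exchanged.  If e > 2, choosing A suitably
in either grid makes all possible circuits in the two directions cross, which
is impossible, so the forcing number is at most mn.  For every e, sets A with
mn - 1 elements contain no circuit at all.

Lower bounds.  In the matching with horizontal edges only, each 2 x 2 square of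
two parallel edges can be rotated, so a forcing set contains half of the edges.
If it contains no more, then membership alternates along the a-orbits; when
gcd(r, m) = 1 these orbits join all edges of equal parity, so some row avoids the
forcing set and can be rotated. *)

Set Implicit Arguments.
Unset Strict Implicit.
Unset Printing Implicit Defensive.

(** * Matchings as involutions *)

Section Partner.

Variables (T : finType) (adj : rel T).
Hypotheses (adjC : symmetric adj) (adjI : irreflexive adj).
Implicit Types (mu nu : T -> T) (x y z : T).

Definition partner (mu : T -> T) := involutive mu /\ forall x, adj x (mu x).

Definition matching (mu : T -> T) : {set {set T}} :=
  [set [set x; mu x] | x : T].

Lemma partner_neq mu x : partner mu -> (mu x == x) = false.
Proof. by case=> _ aM; apply/eqP=> e; have := aM x; rewrite e adjI. Qed.

Lemma partner_edge mu x y : involutive mu ->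
  y \in [set x; mu x] -> [set x; mu x] = [set y; mu y].
Proof.
by move=> mK; rewrite !inE => /orP[/eqP->|/eqP->] //; rewrite mK setUC.
Qed.

Lemma mem_matching mu x : [set x; mu x] \in matching mu.
Proof. exact: imset_f. Qed.

Lemma pm_matching mu : partner mu -> perfect_matching adj (matching mu).
Proof.
move=> pmu; have [mK aM] := pmu; apply/andP; split.
  apply/subsetP=> _ /imsetP[x _ ->]; apply/imsetP.
  by exists (x, mu x) => //; rewrite inE /= aM.
apply/forallP=> v; apply/cards1P; exists [set v; mu v].
apply/setP=> E; rewrite !inE; apply/andP/eqP=> [[/imsetP[x _ ->]]|->].
  exact: partner_edge.
by rewrite mem_matching !inE eqxx.
Qed.

Lemma pm_partner (M : {set {set T}}) : perfect_matching adj M ->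
  exists2 mu, partner mu & M = matching mu.
Proof.
move=> /andP[/subsetP sM /forallP uM].
have h v : exists y, adj v y && ([set v; y] \in M).
  have /cards1P[E defE] := uM v.
  have: E \in [set E] by rewrite inE.
  rewrite -defE inE => /andP[EM vE]; have /imsetP[[x y] /= xy eE] := sM _ EM.
  move: vE EM; rewrite eE !inE /= => /orP[/eqP->|/eqP->] EM.
    by exists y; rewrite EM andbT; move: xy; rewrite inE.
  by exists x; rewrite setUC EM andbT adjC; move: xy; rewrite inE.
pose mu v := xchoose (h v).
have aM v : adj v (mu v) by case/andP: (xchooseP (h v)).
have eM v : [set v; mu v] \in M by case/andP: (xchooseP (h v)).
have eu v E F : E \in M -> F \in M -> v \in E -> v \in F -> E = F.
  move=> EM FM vE vF; have /cards1P[H defH] := uM v.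
  have: E \in [set H] by rewrite -defH inE EM.
  have: F \in [set H] by rewrite -defH inE FM.
  by rewrite !inE => /eqP-> /eqP->.
have mN v : mu v != v by apply/eqP=> e; have := aM v; rewrite e adjI.
have mK : involutive mu.
  move=> v; have := eu (mu v) _ _ (eM v) (eM (mu v)); rewrite !inE !eqxx orbT.
  move=> /(_ isT isT) e; have: v \in [set mu v; mu (mu v)] by rewrite -e !inE eqxx.
  by rewrite !inE eq_sym (negPf (mN v)) => /eqP.
exists mu; first by [].
apply/setP=> E; apply/idP/imsetP=> [EM|[x _ ->]//].
have /imsetP[[x y] /= _ eE] := sM _ EM.
have xE : x \in E by rewrite eE !inE eqxx.
by exists x => //; apply: eu xE _; rewrite // !inE eqxx.
Qed.

(** An edge [[set x; mu x]] with [x] in [A] has no second end in [A], so it determines [x]. *)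
Lemma card_edges mu (A : {set T}) : partner mu ->
  (forall x, x \in A -> mu x \notin A) ->
  #|[set [set x; mu x] | x in A]| = #|A|.
Proof.
move=> pmu hA; apply: card_in_imset => x y xA yA e.
have: y \in [set x; mu x] by rewrite e !inE eqxx.
rewrite !inE => /orP[/eqP//|/eqP yx]; by have := hA _ xA; rewrite -yx yA.
Qed.

Lemma forcing_number_le (M S : {set {set T}}) :
  perfect_matching adj M -> forcing_set adj M S -> forcing_number adj M <= #|S|.
Proof.
move=> pM fS; rewrite /forcing_number.
by case: arg_minnP => [|U _]; [exact: forcing_set_id | apply].
Qed.

Lemma forcing_number_attained (M : {set {set T}}) : perfect_matching adj M ->
  exists2 S, forcing_set adj M S & forcing_number adj M = #|S|.
Proof.
move=> pM; rewrite /forcing_number.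
case: arg_minnP => [|U fU _]; first exact: forcing_set_id.
by exists U.
Qed.

(* Switching mu to nu on Z gives a second perfect matching. *)
Lemma not_forcing mu nu (Z : {set T}) (S : {set {set T}}) z :
  partner mu -> partner nu ->
  (forall x, x \in Z -> mu x \in Z) -> (forall x, x \in Z -> nu x \in Z) ->
  z \in Z -> nu z != mu z ->
  (forall x, x \in Z -> [set x; mu x] \notin S) ->
  ~~ forcing_set adj (matching mu) S.
Proof.
move=> [mK aM] [nK aN] mZ nZ zZ zN hS.
pose f x := if x \in Z then nu x else mu x.
have mZ' x : x \notin Z -> mu x \notin Z by apply: contra => /mZ; rewrite mK.
have pf : partner f.
  split=> x; rewrite /f.
    have [xZ|xZ] := boolP (x \in Z); first by rewrite nZ // nK.
    by rewrite (negPf (mZ' _ xZ)) mK.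
  by case: ifP.
apply/negP=> /andP[/subsetP SM /forallP /(_ (matching f))].
rewrite pm_matching //= => /implyP h.
have /h /eqP e : S \subset matching f.
  apply/subsetP=> E ES; have /imsetP[x _ eE] := SM _ ES.
  have [xZ|xZ] := boolP (x \in Z); first by have := hS _ xZ; rewrite -eE ES.
  by have := mem_matching f x; rewrite /f (negPf xZ) -eE.
have: [set z; f z] \in matching mu by rewrite -e mem_matching.
case/imsetP=> x _ ex.
have zx : z \in [set x; mu x] by rewrite -ex !inE eqxx.
move: ex; rewrite (partner_edge mK zx) => ex.
have : f z \in [set z; mu z] by rewrite -ex !inE eqxx orbT.
by rewrite !inE (partner_neq _ pf) /f zZ (negPf zN).
Qed.

(* If deleting the edges at A from M left a non-forcing set, let N be another
   perfect matching through it: going along M and then along N from a vertex of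
   A where M and N differ leads back to A, hence straight ahead. *)
Lemma forcing_number_straight mu (G : T -> T) (A : {set T}) :
  partner mu ->
  (forall x y, x \in A -> y \in A -> ~~ adj x y) ->
  (forall x y, x \in A -> y \in A -> adj y (mu x) -> y != x -> y = G x) ->
  (forall Y : {set T}, Y \subset A -> (forall x, x \in Y -> G x \in Y) ->
     Y = set0) ->
  forcing_number adj (matching mu) + #|A| <= #|matching mu|.
Proof.
move=> pmu iA sA hY; have [mK aM] := pmu.
have mA x : x \in A -> mu x \notin A.
  by move=> xA; apply/negP=> /(iA x _ xA); rewrite aM.
pose E : {set {set T}} := [set [set x; mu x] | x in A].
have EM : E \subset matching mu.
  by apply/subsetP=> _ /imsetP[x _ ->]; exact: mem_matching.
rewrite -(card_edges pmu mA) -/E.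
rewrite -[X in _ <= X](cardsID E) addnC.
have -> : matching mu :&: E = E by apply/setIidPr.
rewrite leq_add2l; apply: forcing_number_le; first exact: pm_matching.
rewrite /forcing_set subsetDl; apply/forallP=> N; apply/implyP.
move=> /andP[/pm_partner[nu pnu ->] /subsetP sN].
have [nK aN] := pnu.
(* The two matchings differ exactly on [D]. The edges of [mu] that avoid [A] lie in both, so every
   edge of [mu] inside [D] has an end in [A]. *)
pose D := [set x | mu x != nu x].
have Dm x : x \in D -> mu x \in D.
  rewrite !inE mK; apply: contra => /eqP e.
  by apply/eqP; apply: (can_inj nK); rewrite nK -e.
have Dn x : x \in D -> nu x \in D.
  rewrite !inE nK; apply: contra => /eqP e.
  by apply/eqP; apply: (can_inj mK); rewrite mK e.
have DA x : x \in D -> (x \in A) || (mu x \in A).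
  move=> xD; apply/negPn/negP=> /norP[xA mxA].
  have : [set x; mu x] \in matching mu :\: E.
    rewrite inE mem_matching andbT; apply/imsetP=> -[y yA e].
    have: y \in [set x; mu x] by rewrite e !inE eqxx.
    by rewrite !inE => /orP[]/eqP yx; rewrite -yx yA in xA mxA.
  move/sN; case/imsetP=> y _ ey.
  have xy : x \in [set y; nu y] by rewrite -ey !inE eqxx.
  move: ey; rewrite (partner_edge nK xy) => ey.
  have : mu x \in [set x; nu x] by rewrite -ey !inE eqxx orbT.
  by rewrite !inE (partner_neq _ pmu) /=; move: xD; rewrite inE => /negPf->.
pose tau x := nu (mu x).
have tauI : injective tau by move=> x y e; apply: (can_inj mK); apply: (can_inj nK).
(* For [x] in [P], the vertex [tau x] is adjacent to [mu x], which is in [A]; hence [tau x] is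
   outside [A] and its [mu]-partner is in [A]. So [tau] maps [P] into itself and, being injective,
   permutes it. *)
pose P := [set x in D | mu x \in A].
have tP : tau @: P = P.
  apply/eqP; rewrite eqEcard (card_imset _ tauI) leqnn andbT.
  apply/subsetP=> _ /imsetP[x /[!inE] /andP[xD mxA] ->].
  have nD : nu (mu x) \in D by apply/Dn/Dm; rewrite inE.
  rewrite -[_ != _]/(mu (tau x) != nu (tau x)); move: (DA _ nD).
  rewrite inE in nD; rewrite /tau nD /= => /orP[nA|//].
  by have := iA _ _ mxA nA; rewrite aN.
have Y0 : D :&: A = set0.
  apply: hY => [|x /[!in_setI] /andP[xD xA]]; first exact: subsetIr.
  (* Otherwise [tau x] is in [P], hence so is [x], and the adjacent vertices [x] and [mu x] are both
     in [A]. *)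
  have nxA : nu (mu x) \in A.
    have nD : nu (mu x) \in D by apply/Dn/Dm.
    apply/negPn/negP=> nA; have := DA _ nD; rewrite (negPf nA) /= => mnA.
    have : tau x \in tau @: P by rewrite tP in_set nD.
    rewrite mem_imset // in_set xD => mxA.
    by have := iA _ _ xA mxA; rewrite aM.
  have <- : nu (mu x) = G x; last by rewrite nxA Dn ?Dm.
  apply: sA => //; first by rewrite adjC aN.
  by apply: contraTneq xD => e; rewrite inE -e nK e eqxx.
have D0 x : mu x = nu x.
  apply/eqP/negPn/negP=> xD; have xD' : x \in D by rewrite inE.
  have := in_set0 x; have := in_set0 (mu x); rewrite -Y0 !in_setI xD' Dm //=.
  by have := DA _ xD' => /orP[]->.
by apply/eqP/eq_imset => x; rewrite D0.
Qed.

End Partner.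

(** * Grids and straight circuits *)

(** Passing from the last row to row 0 may shift the columns, but keeps their parity. The two
    coordinates need not determine the vertex: in the second grid on the torus, [row] is the column
    modulo a gcd and [b] moves down. *)
Record grid (T : finType) (a ai b bi : T -> T) (N : nat) (row : T -> nat)
    (Q : nat) (col : T -> nat) : Prop := Grid {
  grid_aK : cancel a ai;
  grid_aiK : cancel ai a;
  grid_bK : cancel b bi;
  grid_biK : cancel bi b;
  grid_abC : forall x, a (b x) = b (a x);
  grid_row : forall x, row x < N;
  grid_row_a : forall x,
    row (a x) = if (row x).+1 == N then 0 else (row x).+1;
  grid_row_b : forall x, row (b x) = row x;
  grid_col : forall x, col x < Q;
  grid_col_b : forall x,
    col (b x) = if (col x).+1 == Q then 0 else (col x).+1;
  grid_col_a : forall x, (row x).+1 < N -> col (a x) = col x;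
  grid_odd_col_a : forall x, odd (col (a x)) = odd (col x);
  grid_evenN : ~~ odd N;
  grid_evenQ : ~~ odd Q;
  grid_N3 : 3 < N;
  grid_Q3 : 3 < Q;
  grid_row_orbit : forall x y, row x = row y -> exists k, y = iter k b x
}.

(* G x is the vertex reached from x by going straight across the edge at x. *)
Record straight (T : finType) (a ai b bi mu G : T -> T) : Prop := Straight {
  straight_muK : involutive mu;
  straight_mu : forall x, [\/ mu x = a x, mu x = ai x, mu x = b x | mu x = bi x];
  straight_a : forall x, mu x = a x -> G x = a (a x);
  straight_ai : forall x, mu x = ai x -> G x = ai (ai x);
  straight_b : forall x, mu x = b x -> G x = b (b x);
  straight_bi : forall x, mu x = bi x -> G x = bi (bi x)
}.

(** In the order [a], [ai], [b], [bi], the [o]'s mark the direction in which a circuit leaves a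
    vertex and the [i]'s the one from which it arrives. *)
Lemma div_balance (o1 o2 o3 o4 i1 i2 i3 i4 : int) :
  (o1 + o2 + o3 + o4 = 1 -> i1 + i2 + i3 + i4 = 1 ->
  (o3 - i3) - (i4 - o4) + (o1 - i1) - (i2 - o2) = 0)%R.
Proof. lia. Qed.

(** * Circuits as minimal stable sets *)

Section Circuit.

Variables (T : finType) (G : T -> T).
Implicit Type C : {set T}.

Definition gstable C := forall x, x \in C -> G x \in C.

(* Minimality makes the straight step G a single cycle on C. *)
Definition circuit C :=
  minset [pred D : {set T} | (D != set0) && [forall x in D, G x \in D]] C.

Lemma gstableP C : reflect (gstable C) [forall x in C, G x \in C].
Proof. exact: (iffP forall_inP). Qed.

Lemma circuit_neq0 C : circuit C -> exists x, x \in C.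
Proof. by move/minsetp=> /andP[/set0Pn]. Qed.

Lemma circuit_stable C : circuit C -> gstable C.
Proof. by move/minsetp=> /andP[_ /gstableP]. Qed.

Lemma circuit_min C (D : {set T}) x :
  circuit C -> x \in D -> gstable D -> D \subset C -> D = C.
Proof.
move=> cC xD sD; apply: minsetinf cC _ => /=.
by apply/andP; split; [apply/set0Pn; exists x | apply/gstableP].
Qed.

Lemma circuit_exists C x : x \in C -> gstable C ->
  exists2 D, circuit D & D \subset C.
Proof.
move=> xC sC; set P := [pred D : {set T} | (D != set0) && [forall x in D, G x \in D]].
have PC : P C by apply/andP; split; [apply/set0Pn; exists x | apply/gstableP].
by case: (minset_exists PC) => D; exists D.
Qed.

(** Induction along a circuit: the vertices of [C] with [p] form a nonempty stable subset, which is
    [C] by minimality. *)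
Lemma circuit_all C (p : pred T) x : circuit C -> x \in C -> p x ->
  (forall y, y \in C -> p y -> p (G y)) -> forall y, y \in C -> p y.
Proof.
move=> cC xC px pG y; suff <- : [set z in C | p z] = C by rewrite inE => /andP[].
apply: (circuit_min (x := x) cC); rewrite ?inE ?xC //.
  by move=> z /[!inE] /andP[zC pz]; rewrite circuit_stable ?pG.
by apply/subsetP=> z; rewrite inE => /andP[].
Qed.

(** The image is again nonempty, stable and inside [C]. It follows that [G] permutes [C]. *)
Lemma circuit_imset C : circuit C -> G @: C = C.
Proof.
move=> cC; have [x xC] := circuit_neq0 cC; have sC := circuit_stable cC.
apply: (circuit_min (x := G x) cC); first exact: imset_f.
  by move=> _ /imsetP[y yC ->]; apply/imset_f/sC.
by apply/subsetP=> _ /imsetP[y yC ->]; exact: sC.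
Qed.

Lemma circuit_inj C : circuit C -> {in C &, injective G}.
Proof. by move=> cC; apply/imset_injP; rewrite circuit_imset. Qed.

Lemma circuit_surj C w : circuit C -> w \in C -> exists2 u, u \in C & G u = w.
Proof.
move=> cC; rewrite -{1}(circuit_imset cC) => /imsetP[u uC ->].
by exists u.
Qed.

Lemma circuit_const (V : eqType) (h : T -> V) C : circuit C ->
  (forall y, y \in C -> h (G y) = h y) ->
  forall x y, x \in C -> y \in C -> h x = h y.
Proof.
move=> cC hG x y xC yC; apply/eqP; rewrite eq_sym.
apply: (circuit_all (p := fun z => h z == h x) cC xC) yC => [|z zC /eqP<-] //.
by rewrite hG.
Qed.

Lemma circuit_meet C D x : circuit C -> circuit D -> x \in C -> x \in D -> C = D.
Proof.
move=> cC cD xC xD; have sI : gstable (C :&: D).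
  by move=> y /[!inE] /andP[yC yD]; rewrite !circuit_stable.
rewrite -(circuit_min (x := x) cC _ sI) ?inE ?xC ?subsetIl //.
by rewrite -{2}(circuit_min (x := x) cD _ sI) ?inE ?xC ?subsetIr.
Qed.

End Circuit.

(** * Parity classes, flow and height of a circuit *)

Section GridTheory.

Variables (T : finType) (a ai b bi : T -> T) (N : nat) (row : T -> nat).
Variables (Q : nat) (col : T -> nat) (mu G : T -> T).
Hypotheses (gr : grid a ai b bi N row Q col) (st : straight a ai b bi mu G).

Let aK := grid_aK gr.
Let aiK := grid_aiK gr.
Let bK := grid_bK gr.
Let biK := grid_biK gr.
Let muK := straight_muK st.

Lemma abC x : a (b x) = b (a x). Proof. exact: (grid_abC gr). Qed.
Lemma abiC x : a (bi x) = bi (a x).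
Proof. by apply: (can_inj bK); rewrite -abC !biK. Qed.

Lemma row_a x : row (a x) = if (row x).+1 == N then 0 else (row x).+1.
Proof. exact: (grid_row_a gr). Qed.
Lemma row_b x : row (b x) = row x. Proof. exact: (grid_row_b gr). Qed.
Lemma row_bi x : row (bi x) = row x. Proof. by rewrite -row_b biK. Qed.
Lemma row_ai x : row (ai x) = if row x == 0 then N.-1 else (row x).-1.
Proof.
have := row_a (ai x); rewrite aiK; have := grid_row gr (ai x).
by case: ifP => /eqP ? ? ?; case: ifP => /eqP ?; lia.
Qed.
Lemma col_b x : col (b x) = if (col x).+1 == Q then 0 else (col x).+1.
Proof. exact: (grid_col_b gr). Qed.
Lemma col_bi x : col (bi x) = if col x == 0 then Q.-1 else (col x).-1.
Proof.
have := col_b (bi x); rewrite biK; have := grid_col gr (bi x).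
by case: ifP => /eqP ? ? ?; case: ifP => /eqP ?; lia.
Qed.
Lemma col_a x : (row x).+1 < N -> col (a x) = col x.
Proof. exact: (grid_col_a gr). Qed.
Lemma col_ai x : 0 < row x -> col (ai x) = col x.
Proof.
move=> x0; rewrite -[in RHS](aiK x) col_a // row_ai.
by have := grid_row gr x; case: ifP; lia.
Qed.

Lemma oddr_a x : odd (row (a x)) = ~~ odd (row x).
Proof.
by rewrite row_a; case: eqP => // e; have := grid_evenN gr; rewrite -e /=; lia.
Qed.
Lemma oddr_ai x : odd (row (ai x)) = ~~ odd (row x).
Proof. by rewrite -{2}(aiK x) oddr_a negbK. Qed.
Lemma oddc_b x : odd (col (b x)) = ~~ odd (col x).
Proof.
by rewrite col_b; case: eqP => // e; have := grid_evenQ gr; rewrite -e /=; lia.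
Qed.
Lemma oddc_bi x : odd (col (bi x)) = ~~ odd (col x).
Proof. by rewrite -{2}(biK x) oddc_b negbK. Qed.
Lemma oddc_a x : odd (col (a x)) = odd (col x).
Proof. exact: (grid_odd_col_a gr). Qed.
Lemma oddc_ai x : odd (col (ai x)) = odd (col x).
Proof. by rewrite -{2}(aiK x) oddc_a. Qed.

Definition oddE := (row_b, row_bi, oddr_a, oddr_ai, oddc_b, oddc_bi, oddc_a, oddc_ai).

Lemma nbr_neq x : [/\ (a x == ai x) = false, (b x == bi x) = false,
  (a x == b x) = false & (a x == bi x) = false] /\
  ((ai x == b x) = false /\ (ai x == bi x) = false).
Proof.
have N3 := grid_N3 gr; have Q3 := grid_Q3 gr.
have rx := grid_row gr x; have cx := grid_col gr x.
do !split; apply/eqP=> e.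
- by have := congr1 row e; rewrite row_a row_ai; do 2!case: eqP; lia.
- by have := congr1 col e; rewrite col_b col_bi; do 2!case: eqP; lia.
all: by have := congr1 (odd \o row) e; rewrite /= !oddE; case: odd.
Qed.

Lemma nbrE x : ((a x == ai x) = false) * ((ai x == a x) = false) *
  ((b x == bi x) = false) * ((bi x == b x) = false) *
  ((a x == b x) = false) * ((b x == a x) = false) *
  ((a x == bi x) = false) * ((bi x == a x) = false) *
  ((ai x == b x) = false) * ((b x == ai x) = false) *
  ((ai x == bi x) = false) * ((bi x == ai x) = false).
Proof. by have [[? ? ? ?] [? ?]] := nbr_neq x; do !split=> //; rewrite eq_sym. Qed.

Definition in_cls (p : bool * bool) x := (odd (row x), odd (col x)) == p.
(** The vertices of class [p] form a grid of mesh 2 on which the straight steps move; those of class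
    [dual p] are the centres of its faces, where the height is evaluated. *)
Definition dual (p : bool * bool) := (~~ p.1, ~~ p.2).

Lemma straightP x : [\/ mu x = a x /\ G x = a (a x),
  mu x = ai x /\ G x = ai (ai x), mu x = b x /\ G x = b (b x) |
  mu x = bi x /\ G x = bi (bi x)].
Proof.
case: (straight_mu st x) => e.
- by constructor 1; rewrite (straight_a st e).
- by constructor 2; rewrite (straight_ai st e).
- by constructor 3; rewrite (straight_b st e).
- by constructor 4; rewrite (straight_bi st e).
Qed.

Lemma cls_G x : (odd (row (G x)), odd (col (G x))) = (odd (row x), odd (col x)).
Proof. by case: (straightP x) => -[_ ->]; rewrite !oddE ?negbK. Qed.

Lemma circuit_cls C x : circuit G C -> x \in C ->
  forall y, y \in C -> in_cls (odd (row x), odd (col x)) y.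
Proof.
move=> cC xC y yC; rewrite /in_cls; apply/eqP.
apply: (circuit_const (h := fun y => (odd (row y), odd (col y))) cC) => // z _.
exact: cls_G.
Qed.

Section Flow.

Variables (C : {set T}) (p : bool * bool).
Hypotheses (cC : circuit G C) (clC : forall x, x \in C -> in_cls p x).

Local Open Scope ring_scope.
Import GRing.Theory.

(* The flow of the circuit through y, positive rightwards and downwards. *)
Definition flow y : int :=
  if mu y \in C then (if (mu y == ai y) || (mu y == bi y) then 1 else -1)
  else 0.

Lemma flow_neq0 y : (flow y != 0) = (mu y \in C).
Proof. by rewrite /flow; case: ifP => // _; case: ifP. Qed.

Lemma flow_eq0 y : mu y \notin C -> flow y = 0.
Proof. by rewrite /flow => /negPf->. Qed.

Lemma notin_cls x : ~~ in_cls p x -> x \in C = false.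
Proof. by move=> h; apply: contraNF h => /clC. Qed.

(** The circuit runs through [a w] downwards from [w] or upwards from [a (a w)]; horizontal passages
    would start in a different class. The next three lemmas treat the other directions. *)
Lemma flow_a w : in_cls p w -> flow (a w) =
  Posz ((w \in C) && (mu w == a w)) -
  Posz ((a (a w) \in C) && (mu (a (a w)) == a w)).
Proof.
move=> cw; have m z : (mu z == a w) = (mu (a w) == z).
  by apply/eqP/eqP=> [<-|<-]; rewrite muK.
have n1 : (a (a w) == w) = false by rewrite -{2}(aK w) nbrE.
have k1 : in_cls p (b (a w)) = false.
  by move: cw; rewrite /in_cls !oddE => /eqP<-; rewrite xpair_eqE; case: odd.
have k2 : in_cls p (bi (a w)) = false.
  by move: cw; rewrite /in_cls !oddE => /eqP<-; rewrite xpair_eqE; case: odd.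
rewrite /flow !m aK; case: (straight_mu st (a w)) => ->.
- by rewrite eqxx n1 nbrE; do 2!case: (_ \in C).
- by rewrite aK eqxx [w == a _]eq_sym n1 !andbF andbT; case: (_ \in C).
- rewrite (notin_cls (negbT k1)).
  have -> : (b (a w) == w) = false by apply: contraFF k1 => /eqP->.
  have -> : (b (a w) == a (a w)) = false by rewrite nbrE.
  by rewrite !andbF.
- rewrite (notin_cls (negbT k2)).
  have -> : (bi (a w) == w) = false by apply: contraFF k2 => /eqP->.
  have -> : (bi (a w) == a (a w)) = false by rewrite nbrE.
  by rewrite !andbF.
Qed.

Lemma flow_b w : in_cls p w -> flow (b w) =
  Posz ((w \in C) && (mu w == b w)) -
  Posz ((b (b w) \in C) && (mu (b (b w)) == b w)).
Proof.
move=> cw; have m z : (mu z == b w) = (mu (b w) == z).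
  by apply/eqP/eqP=> [<-|<-]; rewrite muK.
have n1 : (b (b w) == w) = false by rewrite -{2}(bK w) nbrE.
have k1 : in_cls p (a (b w)) = false.
  by move: cw; rewrite /in_cls !oddE => /eqP<-; rewrite xpair_eqE; case: odd.
have k2 : in_cls p (ai (b w)) = false.
  by move: cw; rewrite /in_cls !oddE => /eqP<-; rewrite xpair_eqE; case: odd.
rewrite /flow !m bK; case: (straight_mu st (b w)) => ->.
- rewrite (notin_cls (negbT k1)).
  have -> : (a (b w) == w) = false by apply: contraFF k1 => /eqP->.
  have -> : (a (b w) == b (b w)) = false by rewrite nbrE.
  by rewrite !andbF.
- rewrite (notin_cls (negbT k2)).
  have -> : (ai (b w) == w) = false by apply: contraFF k2 => /eqP->.
  have -> : (ai (b w) == b (b w)) = false by rewrite nbrE.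
  by rewrite !andbF.
- by rewrite eqxx n1 nbrE; do 2!case: (_ \in C).
- by rewrite bK eqxx orbT [w == b _]eq_sym n1 !andbF andbT; case: (_ \in C).
Qed.

Lemma flow_ai w : in_cls p w -> flow (ai w) =
  Posz ((ai (ai w) \in C) && (mu (ai (ai w)) == ai w)) -
  Posz ((w \in C) && (mu w == ai w)).
Proof.
move=> cw; have m z : (mu z == ai w) = (mu (ai w) == z).
  by apply/eqP/eqP=> [<-|<-]; rewrite muK.
have n1 : (ai (ai w) == w) = false by rewrite -{2}(aiK w) nbrE.
have k1 : in_cls p (b (ai w)) = false.
  by move: cw; rewrite /in_cls !oddE => /eqP<-; rewrite xpair_eqE; case: odd.
have k2 : in_cls p (bi (ai w)) = false.
  by move: cw; rewrite /in_cls !oddE => /eqP<-; rewrite xpair_eqE; case: odd.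
rewrite /flow !m; case: (straight_mu st (ai w)) => ->.
- have e1 : (w == bi (ai w)) = false.
    by rewrite -{1}(aiK w) nbrE.
  have e2 : (w == ai (ai w)) = false by rewrite eq_sym.
  by rewrite aiK eqxx e1 e2 !andbF andbT; case: (_ \in C).
- by rewrite eqxx n1; do 2!case: (_ \in C).
- rewrite (notin_cls (negbT k1)).
  have -> : (b (ai w) == w) = false by apply: contraFF k1 => /eqP->.
  have -> : (b (ai w) == ai (ai w)) = false by rewrite nbrE.
  by rewrite !andbF.
- rewrite (notin_cls (negbT k2)).
  have -> : (bi (ai w) == w) = false by apply: contraFF k2 => /eqP->.
  have -> : (bi (ai w) == ai (ai w)) = false by rewrite nbrE.
  by rewrite !andbF.
Qed.

Lemma flow_bi w : in_cls p w -> flow (bi w) =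
  Posz ((bi (bi w) \in C) && (mu (bi (bi w)) == bi w)) -
  Posz ((w \in C) && (mu w == bi w)).
Proof.
move=> cw; have m z : (mu z == bi w) = (mu (bi w) == z).
  by apply/eqP/eqP=> [<-|<-]; rewrite muK.
have n1 : (bi (bi w) == w) = false by rewrite -{2}(biK w) nbrE.
have k1 : in_cls p (a (bi w)) = false.
  by move: cw; rewrite /in_cls !oddE => /eqP<-; rewrite xpair_eqE; case: odd.
have k2 : in_cls p (ai (bi w)) = false.
  by move: cw; rewrite /in_cls !oddE => /eqP<-; rewrite xpair_eqE; case: odd.
rewrite /flow !m; case: (straight_mu st (bi w)) => ->.
- rewrite (notin_cls (negbT k1)).
  have -> : (a (bi w) == w) = false by apply: contraFF k1 => /eqP->.
  have -> : (a (bi w) == bi (bi w)) = false by rewrite nbrE.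
  by rewrite !andbF.
- rewrite (notin_cls (negbT k2)).
  have -> : (ai (bi w) == w) = false by apply: contraFF k2 => /eqP->.
  have -> : (ai (bi w) == bi (bi w)) = false by rewrite nbrE.
  by rewrite !andbF.
- have e1 : (w == ai (bi w)) = false.
    by rewrite -{1}(biK w) nbrE.
  have e2 : (w == bi (bi w)) = false by rewrite eq_sym.
  by rewrite biK eqxx e1 e2 !andbF andbT; case: (_ \in C).
- by rewrite eqxx orbT n1 !andbF; do 2!case: (_ \in C).
Qed.

(** Kirchhoff's law: one step leaves each vertex of [C] and, as [G] permutes [C], one step arrives;
    a vertex of class [p] outside [C] sees neither. *)
Lemma flow_div w : in_cls p w ->
  flow (b w) - flow (bi w) + flow (a w) - flow (ai w) = 0.
Proof.
move=> cw; rewrite flow_a // flow_b // flow_ai // flow_bi //.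
have Ga z : mu z == a z -> G z = a (a z) by move/eqP/(straight_a st).
have Gai z : mu z == ai z -> G z = ai (ai z) by move/eqP/(straight_ai st).
have Gb z : mu z == b z -> G z = b (b z) by move/eqP/(straight_b st).
have Gbi z : mu z == bi z -> G z = bi (bi z) by move/eqP/(straight_bi st).
have ia z : z = a (a w) -> mu z == a w -> G z = w.
  by move=> ->; rewrite -{2}(aK (a w)) => /Gai->; rewrite !aK.
have iai z : z = ai (ai w) -> mu z == ai w -> G z = w.
  by move=> ->; rewrite -{2}(aiK (ai w)) => /Ga->; rewrite !aiK.
have ib z : z = b (b w) -> mu z == b w -> G z = w.
  by move=> ->; rewrite -{2}(bK (b w)) => /Gbi->; rewrite !bK.
have ibi z : z = bi (bi w) -> mu z == bi w -> G z = w.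
  by move=> ->; rewrite -{2}(biK (bi w)) => /Gb->; rewrite !biK.
have [wC|wC] := boolP (w \in C); last first.
  have k z d : (mu z == d -> G z = w) -> ((z \in C) && (mu z == d)) = false.
    move=> h; apply/andP=> -[zC /h e]; move: wC.
    by rewrite -e (circuit_stable cC).
  by rewrite (k _ _ (ia _ erefl)) (k _ _ (iai _ erefl)) (k _ _ (ib _ erefl))
    (k _ _ (ibi _ erefl)).
have [u uC Gu] := circuit_surj cC wC.
have out : Posz (mu w == a w) + Posz (mu w == ai w) + Posz (mu w == b w)
     + Posz (mu w == bi w) = 1.
  by case: (straight_mu st w) => ->; rewrite eqxx !nbrE.
have inn : Posz ((a (a w) \in C) && (mu (a (a w)) == a w)) +
  Posz ((ai (ai w) \in C) && (mu (ai (ai w)) == ai w)) +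
  Posz ((b (b w) \in C) && (mu (b (b w)) == b w)) +
  Posz ((bi (bi w) \in C) && (mu (bi (bi w)) == bi w)) = 1.
  have k z d d' : (mu z == d -> G z = w) -> mu u = d' -> (d == d') = false ->
      Posz ((z \in C) && (mu z == d)) = 0.
    move=> h ud dd'; case: andP => // -[zC zd]; move: dd'; rewrite -ud.
    by rewrite -(eqP zd) (circuit_inj cC zC uC) ?eqxx // h.
  case: (straightP u) => -[e]; rewrite Gu => ew.
  - have eu : u = ai (ai w) by rewrite ew !aK.
    have e' : mu u = ai w by rewrite e eu aiK.
    rewrite -eu uC e' eqxx !(k _ _ _ _ e') ?nbrE //.
    + exact: ibi. + exact: ib. + exact: ia.
  - have eu : u = a (a w) by rewrite ew !aiK.
    have e' : mu u = a w by rewrite e eu aK.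
    rewrite -eu uC e' eqxx !(k _ _ _ _ e') ?nbrE //.
    + exact: ibi. + exact: ib. + exact: iai.
  - have eu : u = bi (bi w) by rewrite ew !bK.
    have e' : mu u = bi w by rewrite e eu biK.
    rewrite -eu uC e' eqxx !(k _ _ _ _ e') ?nbrE //.
    + exact: ib. + exact: iai. + exact: ia.
  - have eu : u = b (b w) by rewrite ew !biK.
    have e' : mu u = b w by rewrite e eu bK.
    rewrite -eu uC e' eqxx !(k _ _ _ _ e') ?nbrE //.
    + exact: ibi. + exact: iai. + exact: ia.
rewrite !andTb; exact: div_balance out inn.
Qed.

Lemma in_cls_mu x : in_cls (dual p) x -> mu x \in C = false.
Proof.
move=> dx; apply: notin_cls; move: dx; rewrite /in_cls /dual (surjective_pairing p).
rewrite !xpair_eqE => /andP[/eqP e1 /eqP e2].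
by case: (straight_mu st x) => ->; rewrite !oddE e1 e2; case: p.1; case: p.2.
Qed.

Lemma flow_dual x : in_cls (dual p) x -> flow x = 0.
Proof. by move=> dx; rewrite flow_eq0 // in_cls_mu. Qed.

(* The signed flow across the vertical ray from row 0 down to x. *)
Definition height x : int := \sum_(k < row x) flow (iter k.+1 ai x).

Lemma height_a x : ((row x).+1 < N)%N -> height (a x) = flow x + height x.
Proof.
move=> xN; rewrite /height row_a ifN ?neq_ltn ?xN // big_ord_recl.
congr (_ + _); first by rewrite /= aK.
by apply: eq_bigr => k _; rewrite lift0 iterSr aK.
Qed.

(** The ray grows by [x] and [a x], and the flow vanishes at [x], whose neighbours are not of class
    [p]. *)
Lemma height_aa x : in_cls (dual p) x -> ((row x).+2 < N)%N ->
  height (a (a x)) = flow (a x) + height x.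
Proof.
move=> dx xN; have x1 := ltnW xN.
have e : row (a x) = (row x).+1 by rewrite row_a ifN // neq_ltn x1.
by rewrite height_a ?e // height_a // (flow_dual dx) add0r.
Qed.

Variables (lo hi : nat).
Hypotheses (lo0 : (0 < lo)%N) (hiN : (hi.+1 < N)%N).
Hypothesis rowC : forall x, x \in C -> (lo <= row x <= hi)%N.

(** The rows from [lo] to [hi] miss row 0 and the last row, so the step from [u] to [G u] cannot
    pass through a row outside this range. *)
Lemma row_mu u : u \in C -> (lo <= row (mu u) <= hi)%N.
Proof.
move=> uC; have rN := grid_row gr u; have := rowC uC.
have := rowC (circuit_stable cC uC).
by case: (straightP u) => -[-> ->]; rewrite ?(row_a, row_ai, row_b, row_bi);
  do ?case: eqP; lia.
Qed.

Lemma flow_row y : mu y \in C -> (lo <= row y <= hi)%N.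
Proof. by move/row_mu; rewrite muK. Qed.

Lemma flow_out y : ~~ (lo <= row y <= hi)%N -> flow y = 0.
Proof. by move=> h; apply: flow_eq0; apply: contra h; exact: flow_row. Qed.

Lemma height_lo x : (row x <= lo)%N -> height x = 0.
Proof.
move=> xlo; rewrite /height big1 // => k _; apply: flow_out.
suff h j : (j <= row x)%N -> row (iter j ai x) = (row x - j)%N.
  by rewrite h ?ltn_ord //; have := ltn_ord k; lia.
elim: j => [|j IH] jx /=; first by rewrite subn0.
by rewrite row_ai IH ?(ltnW jx) //; case: eqP; lia.
Qed.

Lemma row_mu_strict u : u \in C -> odd (row (mu u)) != p.1 ->
  (lo < row (mu u) < hi)%N.
Proof.
move=> uC; have rN := grid_row gr u; have := rowC uC.
have := rowC (circuit_stable cC uC).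
have : odd (row u) == p.1.
  by have := clC uC; rewrite /in_cls (surjective_pairing p) xpair_eqE => /andP[].
case: (straightP u) => -[-> ->] /eqP<-; last 2 first.
- by rewrite !row_b eqxx.
- by rewrite !row_bi eqxx.
all: by move=> + + _; rewrite ?(row_a, row_ai); do ?case: eqP; lia.
Qed.

Lemma flow_out_strict y : odd (row y) != p.1 -> ~~ (lo < row y < hi)%N -> flow y = 0.
Proof.
move=> py h; apply: flow_eq0; apply: contra h => /row_mu_strict.
by rewrite muK; apply.
Qed.

(** Induction on the row: in the strip between the rays of [x] and [b (b x)], going two rows down
    changes both sides by terms that [flow_div], at the vertex of class [p] in the middle of the
    strip, makes equal. *)
Lemma height_bb x : in_cls (dual p) x ->
  height (b (b x)) = height x - flow (b x).
Proof.
have [n] := ubnP (row x); elim: n x => // n IH x; rewrite ltnS => xn dx.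
have ox : odd (row (b x)) != p.1.
  move: dx; rewrite /in_cls xpair_eqE row_b => /andP[/eqP-> _].
  by case: p.1.
have [xlo|xlo] := leqP (row x) lo.
  rewrite !height_lo ?row_b // (flow_out_strict ox) ?subr0 // row_b.
  by rewrite negb_and -leqNgt xlo.
have [z ex] : exists z, x = a (a z) by exists (ai (ai x)); rewrite !aiK.
have r1 : row (a z) = (row x).-1.
  by rewrite -(aK (a z)) -ex row_ai; case: eqP; lia.
have rz : row z = (row x).-2 by rewrite -(aK z) row_ai r1; case: eqP; lia.
have dz : in_cls (dual p) z by move: dx; rewrite ex /in_cls !oddE negbK.
have dbbz : in_cls (dual p) (b (b z)) by move: dz; rewrite /in_cls !oddE negbK.
have zN : ((row z).+2 < N)%N by have := grid_row gr x; rewrite rz; lia.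
have e1 : b (b x) = a (a (b (b z))) by rewrite ex !abC.
have rbb : row (b (b z)) = row z by rewrite !row_b.
have H1 : height (a (a (b (b z)))) = flow (a (b (b z))) + height (b (b z)).
  by apply: height_aa; rewrite ?rbb.
have H2 := height_aa dz zN; rewrite -ex in H2.
have H3 : height (b (b z)) = height z - flow (b z).
  by apply: IH => //; rewrite rz; lia.
have D : flow (a (b (b z))) - flow (a z) + flow (b x) - flow (b z) = 0.
  have E1 : b (a (b z)) = a (b (b z)) by rewrite !abC.
  have E2 : bi (a (b z)) = a z by rewrite abC bK.
  have E3 : a (a (b z)) = b x by rewrite ex !abC.
  rewrite -E1 -E2 -E3 -[X in _ - flow X](aK (b z)).
  apply: flow_div; move: dz; rewrite /in_cls !oddE (surjective_pairing p).
  by rewrite !xpair_eqE; do 2!case: odd; case: p.1; case: p.2.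
by rewrite e1 H1 H2 H3; move: D; clear; lia.
Qed.

Lemma height_const_row x y : in_cls (dual p) x -> in_cls (dual p) y ->
  (hi < row x)%N -> row x = row y -> height x = height y.
Proof.
move=> dx dy hx exy; have [k ek] := grid_row_orbit gr exy.
(* Both vertices have the same column parity, so the row can be followed in double steps. *)
have ok : ~~ odd k.
  have ock j : odd (col (iter j b x)) = odd j (+) odd (col x).
    by elim: j => //= j IH; rewrite oddc_b IH addNb.
  move: dx dy; rewrite /in_cls !xpair_eqE ek ock => /andP[_ /eqP->].
  by case/andP=> _; case: odd => //; case: p.2.
rewrite ek -(odd_double_half k) (negPf ok) add0n.
have dj j : in_cls (dual p) (iter j.*2 b x) /\ row (iter j.*2 b x) = row x.
  by elim: j => // j []; rewrite doubleS /= /in_cls !oddE negbK.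
elim: k./2 => // j IH; have [d r] := dj j.
rewrite doubleS /= height_bb // -IH flow_out ?subr0 // row_b r.
by rewrite negb_and -(ltnNge hi) hx orbT.
Qed.

(** There is no flow past row [hi]. The constant is the net number of times that [C] winds around
    horizontally. *)
Lemma height_const x y : in_cls (dual p) x -> in_cls (dual p) y ->
  (hi < row x)%N -> (hi < row y)%N -> height x = height y.
Proof.
wlog: x y / (row x <= row y)%N => [h dx dy hx hy|].
  by case: (leqP (row x) (row y)) => [|/ltnW] /h -> //.
have [n] := ubnP (row y - row x); elim: n x => // n IH x.
rewrite ltnS => xn xy dx dy hx hy.
have [e|ne] := eqVneq (row x) (row y); first exact: height_const_row.
have yN := grid_row gr y.
have orow z : in_cls (dual p) z -> odd (row z) = ~~ p.1.
  by rewrite /in_cls xpair_eqE => /andP[/eqP].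
have par := orow _ dx; rewrite -(orow _ dy) in par.
have r2 : ((row x).+2 <= row y)%N.
  have [e|e] := eqVneq (row y) (row x).+1; last by move: ne xy e; clear; lia.
  by move: par; rewrite e /=; case: odd.
have r1 : row (a x) = (row x).+1 by rewrite row_a; case: eqP; lia.
have ra : row (a (a x)) = (row x).+2 by rewrite row_a r1; case: eqP; lia.
rewrite -(IH (a (a x))) ?ra //; last first.
- exact: ltnW (ltnW _).
- by move: dx; rewrite /in_cls !oddE negbK.
- by move: xn xy ne; clear; lia.
by rewrite height_aa ?flow_out ?add0r // ?r1; move: hx r2 yN; clear; lia.
Qed.

(** Straight steps in the dual class never cross [C]: the vertex [mu y] in the middle is matched to
    [y], which is not in [C], so it carries no flow. The two side conditions keep the step away from
    the seam between the last row and row 0. *)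
Lemma height_G y : in_cls (dual p) y ->
  (mu y = a y -> ((row y).+2 < N)%N) -> (mu y = ai y -> (1 < row y)%N) ->
  height (G y) = height y.
Proof.
move=> dy ya yai; have f0 : flow (mu y) = 0.
  rewrite flow_eq0 // muK; apply/negP=> /clC; move: dy; rewrite /in_cls.
  by move=> /eqP->; rewrite /dual (surjective_pairing p) xpair_eqE /=; case: p.1.
have dG : in_cls (dual p) (G y) by rewrite /in_cls cls_G.
case: (straightP y) => -[e eG]; rewrite e in f0; rewrite eG in dG *.
- by rewrite height_aa ?f0 ?add0r ?ya.
- have y1 := yai e; have r1 : row (ai y) = (row y).-1 by rewrite row_ai; case: eqP; lia.
  have r2 : row (ai (ai y)) = (row y).-2 by rewrite row_ai r1; case: eqP; lia.
  rewrite -[in RHS](aiK y) -[in RHS](aiK (ai y)) height_aa ?aiK ?f0 ?add0r //.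
  by rewrite r2; have := grid_row gr y; lia.
- by rewrite height_bb // f0 subr0.
- by rewrite -[in RHS](biK y) -[in RHS](biK (bi y)) height_bb // biK f0 subr0.
Qed.

End Flow.

(* If the height vanished below C, the vertices of nonzero height would contain a
   circuit C' of smaller depth. The height of C' is constant on C, zero at a vertex
   of C above C' and, by induction, nonzero at a vertex of C below C'. *)
Lemma height_neq0 p (C : {set T}) hi x : circuit G C ->
  (forall u, u \in C -> in_cls p u) ->
  (forall u, u \in C -> 0 < row u <= hi) -> hi.+1 < N ->
  in_cls (dual p) x -> hi < row x -> height C x <> 0%R.
Proof.
have [n] := ubnP hi; elim: n p C hi x => // n IH p C hi x.
rewrite ltnS => hin cC clC rC hiN dx hx h0.
have orow q z : in_cls q z -> odd (row z) = q.1.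
  by rewrite /in_cls => /eqP<-.
have [u0 u0C] := circuit_neq0 cC; have ru0 := rC _ u0C.
(* If [hi] has the wrong parity, [C] has no vertex in row [hi], and [hi] can be lowered by one. *)
have [oh|oh] := eqVneq (odd hi) p.1; last first.
  apply: (IH p C hi.-1 x) => //; [lia | | lia | lia].
  move=> u uC; have := rC _ uC; case: (eqVneq (row u) hi) => [e|]; last by lia.
  by move: oh; rewrite -e (orow p) ?eqxx ?clC.
have Z y : in_cls (dual p) y -> hi < row y -> height C y = 0%R.
  by move=> dy hy; rewrite (height_const cC clC _ hiN rC dy dx).
pose D := [set y | in_cls (dual p) y && (height C y != 0%R)].
have rD y : y \in D -> 1 < row y < hi.
  rewrite inE => /andP[dy /eqP hy]; apply/andP; split.
    by rewrite ltnNge; apply/negP=> /(height_lo cC (ltn0Sn 0) hiN rC).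
  have : row y <= hi by rewrite leqNgt; apply/negP=> /(Z _ dy).
  rewrite leq_eqVlt => /orP[/eqP e|//].
  by move: oh; rewrite -e (orow _ _ dy) /=; case: p.1.
(* The heights on the two sides of a step of [C] differ by its flow, so they are not both zero. *)
have [y0 y0D] : exists y, y \in D.
  have fu : flow C (mu u0) != 0%R by rewrite flow_neq0 muK.
  have or z z' : in_cls (dual p) z -> in_cls (dual p) z' ->
      height C z <> height C z' -> exists y, y \in D.
    move=> dz dz' h; have [e|e] := eqVneq (height C z) 0%R.
      by exists z'; rewrite inE dz' -e eq_sym; apply/eqP.
    by exists z; rewrite inE dz.
  have cu := clC _ u0C.
  have vert : in_cls (dual p) (bi (mu u0)) -> exists y, y \in D.
    move=> dz; apply: (or (b (b (bi (mu u0)))) _ _ dz).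
      by move: dz; rewrite /in_cls !oddE !negbK.
    rewrite (height_bb cC clC _ hiN rC dz) // biK.
    by move/eqP: fu; clear; lia.
  have hori : row (mu u0) = row u0 -> in_cls (dual p) (ai (mu u0)) -> exists y, y \in D.
    move=> ru dz; apply: (or (a (a (ai (mu u0)))) _ _ dz).
      by move: dz; rewrite /in_cls !oddE !negbK.
    rewrite (height_aa clC dz) ?row_ai ?ru ?aiK; last by case: eqP; lia.
    by move/eqP: fu; clear; lia.
  by case: (straight_mu st u0) => e; [apply: vert | apply: vert | apply: hori |
    apply: hori]; rewrite ?e ?row_b ?row_bi //; move: cu;
    rewrite /in_cls /dual !oddE (surjective_pairing p) !xpair_eqE /=;
    move=> /andP[/eqP-> /eqP->]; rewrite ?eqxx.
have sD : gstable G D.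
  move=> y yD; have ry := rD _ yD; move: yD; rewrite !inE => /andP[dy hy].
  rewrite (height_G cC clC (ltn0Sn 0) hiN rC dy) ?hy ?andbT; last by lia.
    by rewrite /in_cls cls_G.
  by have := andP ry; lia.
have [C' cC' sC'] := circuit_exists y0D sD.
have {}sC' u : u \in C' -> u \in D by apply: (subsetP sC').
have clC' u : u \in C' -> in_cls (dual p) u by move/sC'; rewrite inE => /andP[].
have [w0 w0C'] := circuit_neq0 cC'.
case: (@arg_maxnP _ w0 (fun u => u \in C') row w0C') => v vC' vmax.
case: (@arg_minnP _ w0 (fun u => u \in C') row w0C') => v' v'C' vmin.
have rC' u : u \in C' -> row v' <= row u <= row v.
  by move=> uC'; apply/andP; split; [exact: vmin | exact: vmax].
have rv := rD _ (sC' _ vC'); have rv' := rD _ (sC' _ v'C').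
have /= hv : height C v <> 0%R by move: (sC' _ vC'); rewrite inE => /andP[_ /eqP].
have /= hv' : height C v' <> 0%R by move: (sC' _ v'C'); rewrite inE => /andP[_ /eqP].
(* Otherwise [C] lies above row [v], since its rows have the other parity; the height is then
   constant from that row on, so it is zero at [v] as at [x]. *)
have [u2 u2C ru2] : exists2 u, u \in C & row v < row u.
  have [/exists_inP//|] := boolP [exists u in C, row v < row u].
  rewrite negb_exists_in => /forall_inP h.
  case: hv; rewrite -h0; apply: (height_const cC clC (lo := 1) (hi := (row v).-1)) => //.
  - by move: rv hiN; clear; lia.
  - move=> u uC; have := h _ uC; have := rC _ uC; rewrite -leqNgt.
    have [e|ne] := eqVneq (row u) (row v); last by move: ne; clear; lia.
    have := orow _ _ (clC' _ vC'); rewrite -e (orow _ _ (clC _ uC)) /=.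
    by case: p.1.
  - exact: clC'.
  - by move: rv; clear; lia.
  - by move: rv hx; clear; lia.
(* Otherwise no step of [C] crosses the ray above [v'], and the height vanishes there. *)
have [u1 u1C ru1] : exists2 u, u \in C & row u < row v'.
  have [/exists_inP//|] := boolP [exists u in C, row u < row v'].
  rewrite negb_exists_in => /forall_inP h.
  case: hv'; apply: (height_lo cC (lo := row v') _ hiN) => //.
    by move: rv'; clear; lia.
  by move=> u uC; rewrite leqNgt h //=; have := rC _ uC => /andP[].
have ddp q : in_cls p q -> in_cls (dual (dual p)) q.
  by rewrite /dual /= !negbK -surjective_pairing.
have vN : (row v).+1 < N by move: rv hiN; clear; lia.
have v'0 : 0 < row v' by move: rv'; clear; lia.
have rC1 u : u \in C' -> 0 < row u <= row v.
  by move=> /rC' /andP[h ->]; rewrite (leq_trans v'0 h).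
have vn : row v < n by move: rv hin; clear; lia.
apply: (IH (dual p) C' (row v) u2 vn cC' clC' rC1 vN (ddp _ (clC _ u2C)) ru2).
rewrite -(height_lo cC' v'0 vN rC' (ltnW ru1)).
apply: (circuit_const cC) => // y yC.
have ry := rC _ yC; have rGy := rC _ (circuit_stable cC yC).
apply: (height_G cC' clC' v'0 vN rC') => [|e|e]; first exact: ddp (clC _ yC).
- have r1 : row (a y) = (row y).+1.
    by rewrite row_a; move: ry hiN; clear; case: eqP; lia.
  rewrite (straight_a st e) row_a r1 in rGy; move: ry hiN rGy; clear.
  by case: eqP; lia.
- rewrite (straight_ai st e) !row_ai in rGy; move: ry hiN rGy; clear.
  by do 2!case: eqP; lia.
Qed.

End GridTheory.

(** * Circuits that wind around, and straight runs along rows and columns *)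

Section GridCircuits.

Variables (T : finType) (a ai b bi : T -> T) (N : nat) (row : T -> nat).
Variables (Q : nat) (col : T -> nat) (mu G : T -> T).
Hypotheses (gr : grid a ai b bi N row Q col) (st : straight a ai b bi mu G).

Let aK := grid_aK gr.
Let aiK := grid_aiK gr.
Let bK := grid_bK gr.
Let biK := grid_biK gr.
Let muK := straight_muK st.
Local Notation cls := (in_cls row col).
Let oddE := oddE gr.

Lemma iter_a_coord j x : row x + j < N ->
  row (iter j a x) = row x + j /\ col (iter j a x) = col x.
Proof.
elim: j => [|j IH] jN /=; first by rewrite addn0.
have [|e1 e2] := IH; first by rewrite (leq_trans _ jN) // addnS.
have h : (row (iter j a x)).+1 < N by rewrite e1 -addnS.
by rewrite (row_a gr) (col_a gr h) e2 e1 ifN ?addnS // neq_ltn -addnS jN.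
Qed.

Lemma iter_ai_coord j x : j <= row x ->
  row (iter j ai x) = row x - j /\ col (iter j ai x) = col x.
Proof.
elim: j => [|j IH] jx /=; first by rewrite subn0.
have [|e1 e2] := IH; first exact: ltnW.
have h : 0 < row (iter j ai x) by rewrite e1 subn_gt0.
rewrite (row_ai gr) (col_ai gr h) e2 e1 ifN; last by rewrite -lt0n subn_gt0.
by rewrite subnS.
Qed.

Lemma col_reach u j : j < Q -> exists2 w, row w = row u & col w = j.
Proof.
elim: j => [_|j IH jQ]; last first.
  have [w rw cw] := IH (ltnW jQ); exists (b w); first by rewrite (row_b gr).
  by rewrite (col_b gr) cw ifN // neq_ltn jQ.
have [n] := ubnP (col u); elim: n u => // n IH u; rewrite ltnS => un.
have [u0|u0] := eqVneq (col u) 0; first by exists u.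
have [|w rw cw] := IH (bi u); last by exists w; rewrite // rw (row_bi gr).
by rewrite (col_bi gr) (negPf u0); move: u0 un; clear; lia.
Qed.

(** As [N] is even, the last row is odd: an even circuit that avoids row 0 also avoids the last
    row. *)
Lemma even_row_bound p x : cls (false, p) x -> row x != 0 ->
  0 < row x <= N.-2.
Proof.
rewrite /in_cls xpair_eqE => /andP[/eqP ox _] x0.
have [e|ne] := eqVneq (row x) N.-1; last first.
  by have := grid_row gr x; move: x0 ne; clear; lia.
have := grid_evenN gr; have := grid_N3 gr; rewrite -(ltn_predK (grid_N3 gr)) -e /=.
by rewrite ox.
Qed.

(* A nonzero height means that every vertical line is crossed. *)
Lemma circuit_meets_col p C w : circuit G C ->
  (forall u, u \in C -> cls (false, p) u) ->
  (forall u, u \in C -> row u != 0) -> cls (false, p) w ->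
  exists2 y, y \in C & col y = col w.
Proof.
move=> cC clC rC cw; have N3 := grid_N3 gr.
have rC' u : u \in C -> 0 < row u <= N.-2.
  by move=> uC; apply: even_row_bound (clC _ uC) (rC _ uC).
have rw : row w <= N.-2.
  by have [->|/(even_row_bound cw)/andP[]//] := eqVneq (row w) 0.
(* [w'] is the vertex below [w] in the last even row, and [x] below is the dual vertex diagonally
   past it, in the last row. *)
pose w' := iter (N.-2 - row w) a w.
have [|rw' cw'] := @iter_a_coord (N.-2 - row w) w; first by move: rw N3; clear; lia.
rewrite -/w' subnKC // in rw'; rewrite -/w' in cw'.
have cls_w' : cls (false, p) w'.
  move: cw; rewrite /in_cls !xpair_eqE cw' rw' => /andP[_ ->].
  have := grid_evenN gr; move: N3; case: (N) => [|[|M]] //=.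
  by rewrite negbK => _ /negPf->.
pose x := b (a w').
have dx : cls (dual (false, p)) x.
  move: cls_w'; rewrite /in_cls !oddE /= !xpair_eqE.
  by case/andP=> /eqP-> /eqP->; rewrite !eqxx.
have rx : row x = N.-1.
  rewrite /x (row_b gr) (row_a gr) rw'; case: eqP => //; move: N3; clear; lia.
have hiN : (N.-2).+1 < N by move: N3; clear; lia.
have hx : N.-2 < row x by rewrite rx; move: N3; clear; lia.
have [/exists_inP[y yC /eqP]|] := boolP [exists y in C, col y == col w].
  by exists y.
rewrite negb_exists_in => /forall_inP h.
case: (height_neq0 gr st cC clC rC' hiN dx hx).
rewrite /height big1 // => k _; apply: flow_eq0; apply/negP.
set y := iter _ ai x => uC; have [_ cy] := iter_ai_coord (ltn_ord k).
rewrite -/y -/x in cy.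
have cy' : col y = col (b w').
  by rewrite cy /x -(abC gr) (col_a gr) // (row_b gr) rw'.
have cbi z : col z = col (b w') -> col (bi z) = col w.
  by move=> e; rewrite (col_bi gr) e -(col_bi gr) bK cw'.
have ey : mu (mu y) = y by rewrite muK.
(* Hence the circuit passes [y] horizontally, so it starts from or ends at [bi y], which is in the
   column of [w]. *)
have oc : odd (col (mu y)) != odd (col y).
  rewrite cy' (oddc_b gr).
  have := clC _ uC; rewrite /in_cls xpair_eqE => /andP[_ /eqP->].
  by move: cls_w'; rewrite /in_cls xpair_eqE => /andP[_ /eqP->]; case: (p).
case: (straightP st (mu y)) => -[e eG]; rewrite ey in e.
- by move: oc; rewrite {2}e oddE eqxx.
- by move: oc; rewrite {2}e oddE eqxx.
- by have /eqP[] := h _ uC; rewrite -[mu y]bK -e cbi.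
- have /eqP[] := h _ (circuit_stable cC uC).
  by rewrite eG -e cbi.
Qed.

(** The circuit winds around and meets columns 0 and 2. From a vertex in column 0 it can only move
    vertically, so it stays in the columns divisible by [e] and misses column 2. *)
Lemma circuit_cross_col e C : 2 < e -> (forall x, col (a x) = col x %[mod e]) ->
  (forall x, e %| col x -> mu x = a x \/ mu x = ai x) ->
  circuit G C -> (forall u, u \in C -> cls (false, false) u) ->
  (forall u, u \in C -> row u != 0) -> False.
Proof.
move=> e2 ea ev cC clC rC; have [u0 u0C] := circuit_neq0 cC.
have reach j : j < Q -> ~~ odd j -> exists2 y, y \in C & col y = j.
  move=> jQ oj; have [w rw cw] := col_reach u0 jQ.
  rewrite -cw; apply: (circuit_meets_col cC clC rC).
  move: (clC _ u0C); rewrite /in_cls !xpair_eqE cw rw.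
  by rewrite (negPf oj) => /andP[->].
have Q3 := grid_Q3 gr.
have [y yC cy] := reach 0 (ltnW (ltnW (ltnW Q3))) isT.
have [y2 y2C cy2] := reach 2 (ltnW Q3) isT.
have : e %| col y2.
  apply: (circuit_all (p := fun z => e %| col z) cC yC) y2C => [|z zC].
    by rewrite cy.
  have eai x : col (ai x) = col x %[mod e] by rewrite -[in RHS](aiK x) ea.
  move=> ez; case: (ev z ez) => m.
    by rewrite (straight_a st m) /dvdn !ea.
  by rewrite (straight_ai st m) /dvdn !eai.
by rewrite cy2 gtnNdvd.
Qed.

(** A horizontal run cannot turn back, because the vertex just passed is matched already; so it goes
    around the whole row. *)
Lemma row_run (Y : {set T}) x0 : x0 \in Y -> gstable G Y ->
  (forall x, x \in Y -> mu x = b x \/ mu x = bi x) ->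
  forall z, row z = row x0 ->
    (mu z = b z \/ mu z = bi z) /\ (odd (col z) = odd (col x0) -> z \in Y).
Proof.
move=> x0Y sY hY z ez.
have [k ek] := grid_row_orbit gr (esym ez).
have [k' ek'] := grid_row_orbit gr ez.
case: (hY _ x0Y) => e0.
- have ev j : iter j.*2 b x0 \in Y /\ mu (iter j.*2 b x0) = b (iter j.*2 b x0).
    elim: j => // j [yY ey]; rewrite doubleS /=; set y := iter _ b x0 in yY ey *.
    have bbY : b (b y) \in Y by rewrite -(straight_b st ey) sY.
    split=> //; case: (hY _ bbY) => // e; move: e;
      rewrite bK -[RHS]ey => /(can_inj muK) e.
    have : (b (b y) == bi (b y)) = false by rewrite (nbrE gr).
    by rewrite bK e eqxx.
  have oc : odd (col z) = odd k (+) odd (col x0).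
    by rewrite ek; elim: k {ek} => //= j IH; rewrite oddE IH addNb.
  rewrite oc ek -{1 2 3 4 6}(odd_double_half k); have [zY e] := ev k./2.
  case: odd; first by split; [right; rewrite /= bK -{1}e muK | case: odd].
  by split; [left | rewrite zY].
- have ev j : iter j.*2 bi x0 \in Y /\ mu (iter j.*2 bi x0) = bi (iter j.*2 bi x0).
    elim: j => // j [yY ey]; rewrite doubleS /=; set y := iter _ bi x0 in yY ey *.
    have bbY : bi (bi y) \in Y by rewrite -(straight_bi st ey) sY.
    split=> //; case: (hY _ bbY) => // e; move: e;
      rewrite biK -[RHS]ey => /(can_inj muK) e.
    have : (bi (bi y) == b (bi y)) = false by rewrite (nbrE gr).
    by rewrite biK e eqxx.
  have ebi : z = iter k' bi x0.
    rewrite ek'; elim: k' {ek'} => //= j IH.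
    by rewrite -iterS iterSr bK.
  have oc : odd (col z) = odd k' (+) odd (col x0).
    by rewrite ebi; elim: k' {ek' ebi} => //= j IH; rewrite oddE IH addNb.
  rewrite oc ebi -{1 2 3 4 6}(odd_double_half k'); have [zY e] := ev k'./2.
  case: odd; first by split; [left; rewrite /= biK -{1}e muK | case: odd].
  by split; [right | rewrite zY].
Qed.

(** A vertical run keeps its direction as well, so there is no extreme vertex among those of [Y]
    matched downwards, or upwards. *)
Lemma no_column_run (Y : {set T}) x0 : x0 \in Y -> gstable G Y ->
  (forall x, x \in Y -> mu x = a x \/ mu x = ai x) ->
  (forall x, x \in Y -> 0 < row x /\ (row x).+2 < N) -> False.
Proof.
move=> x0Y sY hY rY.
have ra x : x \in Y -> row (a (a x)) = (row x).+2.
  move=> /rY[_ xN].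
  have r1 : row (a x) = (row x).+1 by rewrite (row_a gr) ifN // neq_ltn ltnW.
  by rewrite (row_a gr) r1 ifN // neq_ltn xN.
have rai x : x \in Y -> ai (ai x) \in Y -> row x = (row (ai (ai x))).+2.
  by move=> _ /ra; rewrite !aiK.
have [e0|e0] := hY _ x0Y.
- case: (@arg_maxnP _ x0 (fun x => (x \in Y) && (mu x == a x)) row).
    by rewrite x0Y e0 eqxx.
  move=> x /andP[xY /eqP ex] xmax.
  have aY : a (a x) \in Y by rewrite -(straight_a st ex) sY.
  have := xmax (a (a x)); rewrite aY /= => h.
  have /h : mu (a (a x)) == a (a (a x)); last first.
    by rewrite (ra x xY) => /ltnW; rewrite ltnn.
  case: (hY _ aY) => [->//|]; rewrite aK -[RHS]ex => /(can_inj muK) e.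
  have : (a (a x) == ai (a x)) = false by rewrite (nbrE gr).
  by rewrite aK e eqxx.
- case: (@arg_minnP _ x0 (fun x => (x \in Y) && (mu x == ai x)) row).
    by rewrite x0Y e0 eqxx.
  move=> x /andP[xY /eqP ex] xmin.
  have aY : ai (ai x) \in Y by rewrite -(straight_ai st ex) sY.
  have := xmin (ai (ai x)); rewrite aY /= => h.
  have /h : mu (ai (ai x)) == ai (ai (ai x)); last first.
    by rewrite (rai x xY aY) => /ltnW; rewrite ltnn.
  case: (hY _ aY) => [|->//]; rewrite aiK -[RHS]ex => /(can_inj muK) e.
  have : (ai (ai x) == a (ai x)) = false by rewrite (nbrE gr).
  by rewrite aiK e eqxx.
Qed.

End GridCircuits.

(** * Sets of vertices that meet the complement of a forcing set *)

Section ForcingSets.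

Variables (T : finType) (a ai b bi : T -> T) (N : nat) (row : T -> nat).
Variables (Q : nat) (col : T -> nat) (mu G : T -> T) (adj : rel T).
Hypotheses (gr : grid a ai b bi N row Q col) (st : straight a ai b bi mu G).
Hypotheses (adjC : symmetric adj) (adjI : irreflexive adj).
Hypothesis adjE : forall x y,
  adj x y = [|| y == a x, y == ai x, y == b x | y == bi x].
Hypothesis pmu : partner adj mu.

Let aK := grid_aK gr.
Let aiK := grid_aiK gr.
Let bK := grid_bK gr.
Let biK := grid_biK gr.
Let muK := straight_muK st.
Let oddE := oddE gr.
Local Notation cls := (in_cls row col).

Definition even_cls := [set x | (odd (row x), odd (col x)) == (false, false)].

(** Each edge has one end in [W], which consists of the even class and its diagonal translate. *)
Lemma card_matching_even : #|matching mu| = 2 * #|even_cls|.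
Proof.
pose W := [set x | odd (row x) == odd (col x)].
have mW x : (mu x \in W) = (x \notin W).
  rewrite !inE; case: (straight_mu st x) => ->; rewrite !oddE; by do 2!case: odd.
have -> : matching mu = [set [set x; mu x] | x in W].
  apply/setP=> E; apply/imsetP/imsetP=> -[x xW ->]; last by exists x.
  have [?|/negbTE xnW] := boolP (x \in W); first by exists x.
  by exists (mu x); rewrite ?mW ?xnW // muK setUC.
rewrite (card_edges pmu) => [|x xW]; last by rewrite mW xW.
have -> : W = even_cls :|: [set a (b x) | x in even_cls].
  apply/setP=> x; rewrite in_setU; apply/idP/orP.
    rewrite inE => /eqP e; case ox: (odd (row x)); [right | left].
      apply/imsetP; exists (bi (ai x)); last by rewrite biK aiK.
      by rewrite inE !oddE -e ox.
    by rewrite inE -e ox.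
  by case=> [|/imsetP[y + ->]]; rewrite !inE => /eqP[e1 e2]; rewrite ?oddE e1 e2.
rewrite cardsU card_imset => [|x y]; last by move/(can_inj aK)/(can_inj bK).
rewrite disjoint_setI0 ?cards0 ?subn0 ?mul2n ?addnn //.
rewrite disjoint_subset; apply/subsetP=> x; rewrite !inE => /eqP[e1 e2].
apply/imsetP=> -[y]; rewrite inE => /eqP[e3 e4] ey.
by move: e1; rewrite ey !oddE e3.
Qed.

(** A vertex of [A] next to [mu x], other than [x], is straight ahead or diagonal to [x]; the latter
    is excluded. So [forcing_number_straight] applies unless [A] has a nonempty stable subset, hence
    a circuit. *)
Lemma forcing_king (A : {set T}) :
  (forall x, x \in A ->
    [/\ a x \notin A, b x \notin A, a (b x) \notin A & a (bi x) \notin A]) ->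
  forcing_number adj (matching mu) + #|A| <= 2 * #|even_cls| \/
  exists2 C, circuit G C & forall u, u \in C -> u \in A.
Proof.
move=> kA; have nA z x : z \in A -> x \in A ->
    [\/ x = a z, x = b z, x = a (b z) | x = a (bi z)] -> False.
  by move=> zA xA [] e; have [] := kA _ zA; rewrite -e xA.
have [|] := boolP [forall Y : {set T},
    (Y \subset A) && [forall x in Y, G x \in Y] ==> (Y == set0)].
  move=> /forallP h; left; rewrite -card_matching_even.
  apply: (forcing_number_straight adjC adjI (G := G)) => //.
  - move=> x y xA yA; apply/negP; rewrite adjE => /or4P[]/eqP e.
    + by apply: (nA x y) => //; constructor 1.
    + by apply: (nA y x) => //; constructor 1; rewrite e aiK.
    + by apply: (nA x y) => //; constructor 2.
    + by apply: (nA y x) => //; constructor 2; rewrite e biK.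
  - move=> x y xA yA; rewrite adjE => h4 yx.
    have {h4} h4 : [\/ mu x = a y, mu x = ai y, mu x = b y | mu x = bi y].
      by case/or4P: h4 => /eqP; [constructor 1 | constructor 2 | constructor 3
        | constructor 4].
    case: (straightP st x) => -[e ->]; rewrite e in h4.
    + case: h4 => e'.
      * by case/eqP: yx; rewrite -(aK x) e' aK.
      * by rewrite e' aiK.
      * case: (nA x y) => //; constructor 4.
        by rewrite (abiC gr) e' bK.
      * by case: (nA x y) => //; constructor 3; rewrite (abC gr) e' biK.
    + case: h4 => e'.
      * by rewrite e' aK.
      * by case/eqP: yx; rewrite -(aiK x) e' aiK.
      * by case: (nA y x) => //; constructor 3; rewrite -e' aiK.
      * by case: (nA y x) => //; constructor 4; rewrite -e' aiK.
    + case: h4 => e'.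
      * by case: (nA y x) => //; constructor 4; rewrite (abiC gr) -e' bK.
      * by case: (nA x y) => //; constructor 3; rewrite e' aiK.
      * by case/eqP: yx; rewrite -(bK x) e' bK.
      * by rewrite e' biK.
    + case: h4 => e'.
      * by case: (nA y x) => //; constructor 3; rewrite (abC gr) -e' biK.
      * by case: (nA x y) => //; constructor 4; rewrite e' aiK.
      * by rewrite e' bK.
      * by case/eqP: yx; rewrite -(biK x) e' biK.
  - move=> Y YA sY; apply/eqP; apply: (implyP (h Y)).
    by rewrite YA; apply/gstableP.
rewrite negb_forall => /existsP[Y]; rewrite negb_imply => /andP[/andP[YA sY]].
case/set0Pn=> y yY; right; have [C cC sC] := circuit_exists yY (gstableP _ _ sY).
by exists C => // u /(subsetP sC) /(subsetP YA).
Qed.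

Lemma circuit_row0 C u : circuit G C -> u \in C ->
  (forall v, v \in C -> row v = 0) -> forall z, row z = 0 ->
  (mu z = b z \/ mu z = bi z) /\ (odd (col z) = odd (col u) -> z \in C).
Proof.
have N3 := grid_N3 gr; move=> cC uC C0 z z0.
apply: (row_run gr st uC (circuit_stable cC)); last by rewrite z0 C0.
move=> x xC; have x0 := C0 _ xC; have G0 := C0 _ (circuit_stable cC xC).
case: (straightP st x) => -[e eG]; [exfalso | exfalso | by left | by right].
  by move: G0; rewrite eG !(row_a gr) x0; move: N3; clear; do 2!case: eqP; lia.
by move: G0; rewrite eG !(row_ai gr) x0 /=; move: N3; clear; case: eqP; lia.
Qed.

Lemma row_alternative :
  [\/ forcing_number adj (matching mu) <= #|even_cls|,
    exists C, [/\ circuit G C, forall u, u \in C -> cls (false, false) u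
      & forall u, u \in C -> row u != 0]
  | forall z, row z = 0 -> mu z = b z \/ mu z = bi z].
Proof.
(* The even class with row 0 shifted by one column. A circuit stays in one class, so inside [A] it
   either lies in row 0 or avoids it. *)
pose A := [set x | ~~ odd (row x) &&
  if row x == 0 then odd (col x) else ~~ odd (col x)].
have N3 := grid_N3 gr.
case: (@forcing_king A).
- move=> x; rewrite !inE => /andP[ox].
  rewrite !oddE ox /=.
  by case: ifP => _ h; split=> //; rewrite h.
- move=> h; constructor 1.
  suff hA : #|even_cls| <= #|A| by move: h hA; clear; lia.
  pose f x := if row x == 0 then b x else x.
  rewrite -(card_in_imset (f := f)).
    apply/subset_leq_card/subsetP=> _ /imsetP[x xW ->].
    move: xW; rewrite /f !inE => /eqP[e1 e2].
    by case: ifP => x0; rewrite ?oddE ?e1 ?e2 x0.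
  move=> x y; rewrite !inE /f => /eqP[e1 e2] /eqP[e3 e4].
  case: ifP => _; case: ifP => _ // e.
  - exact: (can_inj bK).
  - by have := congr1 (odd \o col) e; rewrite /= oddE e2 e4.
  - by have := congr1 (odd \o col) e; rewrite /= oddE e2 e4.
case=> C cC CA.
have [u uC] := circuit_neq0 cC.
have cl := circuit_cls gr st cC uC.
have [u0|u0] := eqVneq (row u) 0.
  constructor 3.
  have Arow v : v \in C -> row v = 0 /\ odd (col v).
    move=> vC; have := CA _ vC; have := CA _ uC; have := cl _ vC.
    rewrite !inE u0 eqxx /in_cls => /eqP[-> ->] /andP[_ ->].
    by case: eqP; rewrite ?andbF.
  have C0 v : v \in C -> row v = 0 by case/Arow.
  by move=> z z0; case: (circuit_row0 cC uC C0 z0).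
constructor 2; exists C; split=> // v vC; have := CA _ vC; have := CA _ uC.
  rewrite /in_cls; have /eqP[-> ->] := cl _ vC.
  by rewrite !inE (negPf u0) xpair_eqE !eqbF_neg => /andP[-> ->].
have := cl _ vC; rewrite !inE (negPf u0) => /eqP[-> ->].
by case: eqP => // _ /andP[_ /negPf->]; rewrite andbF.
Qed.


(** * The bound [mn + 1], from sets of [mn - 1] vertices *)

Section Weak.

Hypothesis coord_inj : forall x y, row x = row y -> col x = col y -> x = y.

Lemma no_circuit_col0 C u : circuit G C -> u \in C -> odd (row u) ->
  (forall v, v \in C -> odd (row v) -> col v = 0 /\ (row v).+2 < N) -> False.
Proof.
move=> cC uC ou hC; have cl := circuit_cls gr st cC uC.
have {}hC v : v \in C -> [/\ odd (row v), col v = 0 & (row v).+2 < N].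
  move=> vC; have ov : odd (row v) by have := cl _ vC => /eqP[-> _].
  by have [] := hC _ vC ov.
have Q3 := grid_Q3 gr.
apply: (no_column_run gr st uC (circuit_stable cC)) => x xC; last first.
  by have [+ _ ->] := hC _ xC; case: (row x).
have [_ c0 _] := hC _ xC; have [_ G0 _] := hC _ (circuit_stable cC xC).
case: (straightP st x) => -[e eG]; [by left | by right | exfalso | exfalso].
  by move: G0; rewrite eG !(col_b gr) c0; move: Q3; clear; do 2!case: eqP; lia.
by move: G0; rewrite eG !(col_bi gr) c0 /=; move: Q3; clear; case: eqP; lia.
Qed.

Lemma even_reach_col0 u : u \in even_cls -> 
  exists2 w, cls (false, false) w & row w = row u /\ col w = 0.
Proof.
rewrite inE => /eqP[e1 e2].
have [|w rw cw] := @col_reach _ _ _ _ _ _ _ _ _ gr u 0.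
  by rewrite (ltn_trans _ (grid_Q3 gr)).
by exists w => //; rewrite /in_cls rw cw e1.
Qed.

(** Only one vertex is excepted, namely the one in column 0 and row [N.-2]. *)
Lemma card_even_cls1 (A : {set T}) (f : T -> T) :
  {in even_cls &, injective f} ->
  (forall x, x \in even_cls -> ~~ ((col x == 0) && (N <= (row x).+2)) -> f x \in A) ->
  #|even_cls| <= #|A|.+1.
Proof.
move=> fI fA; pose E := [set x in even_cls | (col x == 0) && (N <= (row x).+2)].
have E1 : #|E| <= 1.
  apply/card_le1_eqP => x y; rewrite !inE => /andP[/eqP[ex _] /andP[/eqP cx rx]].
  move=> /andP[/eqP[ey _] /andP[/eqP cy ry]]; apply: coord_inj; last by rewrite cx.
  have h z : ~~ odd (row z) -> N <= (row z).+2 -> row z = N.-2.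
    move=> oz zN; have zN' := grid_row gr z; have eN := grid_evenN gr.
    have [e|] := eqVneq (row z).+1 N; first by move: eN; rewrite -e /= oz.
    by move: zN zN'; clear; lia.
  by rewrite (h x (negbT ex) rx) (h y (negbT ey) ry).
have := cardsD even_cls E.
have : #|even_cls :&: E| <= 1.
  by rewrite (leq_trans _ E1) // subset_leq_card // subsetIr.
have : #|even_cls :\: E| <= #|A|.
  rewrite -(card_in_imset (f := f)); last first.
    by move=> x y /setDP[xE _] /setDP[yE _]; exact: fI.
  apply/subset_leq_card/subsetP=> _ /imsetP[x /setDP[xE xnE] ->].
  by apply: fA => //; apply: contra xnE => h; rewrite in_set xE.
by clear; lia.
Qed.

(** First try [A]. Its only possible circuit lies in row 0, since one in the even class off row 0
    would wind around and meet column 0. Such a circuit forces row 0 to be matched horizontally, and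
    then [B] has no circuit. *)
Lemma forcing_weak : forcing_number adj (matching mu) <= #|even_cls|.+1.
Proof.
have N3 := grid_N3 gr.
(* The even class with row 0 shifted right and the rest of column 0 shifted down, without the vertex
   that would reach the last row. *)
pose A := [set x | if odd (row x)
  then [&& ~~ odd (col x), col x == 0, 1 < row x & (row x).+2 < N]
  else if row x == 0 then odd (col x) else ~~ odd (col x) && (col x != 0)].
(* Here all of column 0 is shifted down, again without its last vertex, and row 0 is otherwise
   unchanged. *)
pose B := [set x | ~~ odd (col x) && if odd (row x)
  then (col x == 0) && ((row x).+2 < N) else col x != 0].
have r1 x : ~~ odd (row x) -> (row x).+1 < N.
  have := grid_row gr x; have := grid_evenN gr; case: (eqVneq (row x).+1 N).
    by move=> <- /=; rewrite negbK => ->.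
  by move=> ne _ + _; move: ne; clear; lia.
have r3 x : ~~ odd (row x) -> (row x).+2 < N -> (row x).+3 < N.
  move=> ox rN; have [e|] := eqVneq (row x).+3 N; last by move: rN; clear; lia.
  by have := grid_evenN gr; rewrite -e /= negbK ox.
have ra x : (row x).+1 < N -> row (a x) = (row x).+1.
  by move=> xN; rewrite (row_a gr) ifN // neq_ltn xN.
have bound (D : {set T}) : #|even_cls| <= #|D|.+1 ->
    forcing_number adj (matching mu) + #|D| <= 2 * #|even_cls| ->
    forcing_number adj (matching mu) <= #|even_cls|.+1.
  by clear; lia.
case: (@forcing_king A).
- move=> x; rewrite !inE !oddE; case ox: (odd (row x)) => /=.
    case/and4P=> oc /eqP c0 _ rN; have rN1 := ltnW rN.
    by rewrite !ra ?(row_b gr) ?(row_bi gr) //= (negPf oc) (col_a gr) ?c0.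
  have := r1 x (negbT ox); case: eqP => [x0 N1 oc|/eqP x0 xN /andP[oc c0]].
    rewrite x0 in N1; split; rewrite oc ?ra ?(row_b gr) ?(row_bi gr) ?x0 //=.
      by rewrite andbF.
    by rewrite andbF.
  by rewrite (negPf oc) (col_a gr) // (negPf c0) /=.
- apply: bound; pose f x := if row x == 0 then b x else if col x == 0 then a x else x.
  apply: (card_even_cls1 (f := f)) => [x y|x].
    rewrite !inE => /eqP[e1 e2] /eqP[e3 e4]; rewrite /f.
    have par v w : v = w -> (odd (row v), odd (col v)) = (odd (row w), odd (col w)).
      by move=> ->.
    case: ifP => _; [|case: ifP => _]; (case: ifP => _; [|case: ifP => _]) => // e;
      first [exact: (can_inj bK) e | exact: (can_inj aK) e
        | by have := par _ _ e; rewrite !oddE e1 e2 e3 e4].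
  rewrite !inE => /eqP[e1 e2]; rewrite /f negb_and -ltnNge.
  case: (eqVneq (row x) 0) => [x0 _|x0]; first by rewrite !oddE e1 e2 x0 eqxx.
  case: (eqVneq (col x) 0) => [c0|c0] /= rN; last by rewrite e1 e2 (negPf x0).
  have rN1 := ltnW rN; rewrite !oddE e1 e2 (col_a gr) // c0 ra //=.
  by rewrite ltnS lt0n x0 r3 // e1.
move=> [C cC CA]; have [u uC] := circuit_neq0 cC.
have cl := circuit_cls gr st cC uC.
have [ou|ou] := boolP (odd (row u)).
  exfalso; apply: (no_circuit_col0 cC uC ou) => v vC ov.
  by have := CA _ vC; rewrite inE ov => /and4P[_ /eqP].
have meets D : circuit G D -> (forall v, v \in D -> cls (false, false) v) ->
    (forall v, v \in D -> row v != 0) -> exists2 v, v \in D & col v = 0.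
  move=> cD clD rD; have [z zD] := circuit_neq0 cD.
  have [|w cw [_ w0]] := @even_reach_col0 z; first by rewrite inE; exact: clD.
  by rewrite -w0; exact: (circuit_meets_col gr st cD clD rD cw).
have [u0|u0] := eqVneq (row u) 0; last first.
  have := CA _ uC; rewrite inE (negPf ou) (negPf u0) => /andP[ocu c0].
  have clC v : v \in C -> cls (false, false) v.
    by move=> /cl; rewrite (negPf ou) (negPf ocu).
  have hC v : v \in C -> row v != 0 /\ col v != 0.
    move=> vC; have /eqP[e1 e2] := clC _ vC; have := CA _ vC.
    by rewrite inE e1 e2; case: (eqVneq (row v) 0) => // v0 /= ->.
  have [v vC v0] := meets C cC clC (fun v vC => (hC v vC).1).
  by case: (hC _ vC); rewrite v0.
have full z : row z = 0 -> mu z = b z \/ mu z = bi z.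
  have ocu : odd (col u) by have := CA _ uC; rewrite inE (negPf ou) u0.
  have C0 v : v \in C -> row v = 0.
    move=> vC; have /eqP[e1 e2] := cl _ vC; have := CA _ vC.
    by rewrite inE e1 e2 (negPf ou) ocu; case: eqP.
  by move=> z0; case: (circuit_row0 cC uC C0 z0).
have kB x : x \in B ->
    [/\ a x \notin B, b x \notin B, a (b x) \notin B & a (bi x) \notin B].
  rewrite !inE !oddE => /andP[oc]; rewrite (negPf oc) /=.
  case ox: (odd (row x)) => /=.
    by case/andP=> /eqP c0 rN; rewrite (col_a gr) ?c0 // ltnW.
  by move=> c0; rewrite (col_a gr) ?(negPf c0) // r1 ?ox.
have [h|[D cD DB]] := forcing_king kB.
  apply: bound h; pose f x := if col x == 0 then a x else x.
  apply: (card_even_cls1 (f := f)) => [x y|x].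
    rewrite !inE => /eqP[e1 e2] /eqP[e3 e4]; rewrite /f.
    have par v w : v = w -> odd (row v) = odd (row w) by move=> ->.
    case: ifP => _; case: ifP => _ // e;
      first [exact: (can_inj aK) e | by have := par _ _ e; rewrite !oddE e1 e3].
  rewrite !inE => /eqP[e1 e2]; rewrite /f negb_and -ltnNge.
  case: (eqVneq (col x) 0) => [c0|c0] /= rN; last by rewrite e1 e2.
  have rN1 := ltnW rN; rewrite !oddE e1 e2 (col_a gr) // c0 ra //=.
  by rewrite r3 // e1.
have [v vD] := circuit_neq0 cD; have clD := circuit_cls gr st cD vD.
have [ov|ov] := boolP (odd (row v)).
  exfalso; apply: (no_circuit_col0 cD vD ov) => w wD ow.
  by have := DB _ wD; rewrite inE ow => /and3P[_ /eqP].
have ocv : odd (col v) = false.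
  by have := DB _ vD; rewrite inE => /andP[/negPf].
have {}clD w : w \in D -> cls (false, false) w.
  by move=> /clD; rewrite ocv (negPf ov).
have Dcol w : w \in D -> col w != 0.
  by move=> wD; have := DB _ wD; have /eqP[e1 e2] := clD _ wD; rewrite inE e1 e2.
(* A circuit that meets row 0 stays there and fills its even columns, including column 0; one that
   avoids row 0 winds around and meets column 0 too. *)
have [/exists_inP[x xD /eqP x0]|] := boolP [exists x in D, row x == 0].
  have D0 w : w \in D -> row w = 0.
    move=> wD; apply/eqP.
    apply: (circuit_all (p := fun w => row w == 0) cD xD) wD => [|z zD /eqP z0].
      by rewrite x0.
    case: (full _ z0) => e.
      by rewrite (straight_b st e) !(row_b gr) z0.
    by rewrite (straight_bi st e) !(row_bi gr) z0.
  have [|w /eqP[_ ow] [rw w0]] := @even_reach_col0 x; first by rewrite inE; exact: clD.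
  have [|_ wD] := circuit_row0 cD xD D0 (z := w); first by rewrite rw x0.
  have wD' : w \in D by apply: wD; have /eqP[_ ->] := clD _ xD.
  by have := Dcol _ wD'; rewrite w0.
rewrite negb_exists_in => /forall_inP D0.
have [w wD w0] := meets D cD clD D0.
by have := Dcol _ wD; rewrite w0.
Qed.

End Weak.

End ForcingSets.

(** * Circuits in two directions cross *)

Section Crossing.

Variables (T : finType) (a ai b bi : T -> T) (N : nat) (row : T -> nat).
Variables (Q : nat) (col : T -> nat) (mu G : T -> T) (N2 : nat).
Hypotheses (gr : grid a ai b bi N row Q col) (st : straight a ai b bi mu G).

Let row2 x := col x %% N2.

Hypothesis gr2 : grid b bi a ai N2 row2 N row.

Let aK := grid_aK gr.
Let aiK := grid_aiK gr.
Let bK := grid_bK gr.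
Let biK := grid_biK gr.
Let muK := straight_muK st.
Let oddE := oddE gr.

Lemma straightC : straight b bi a ai mu G.
Proof.
case: st => mK m sa sai sb sbi; split=> // x.
by case: (m x) => e; [constructor 3 | constructor 4 | constructor 1 | constructor 2].
Qed.

Lemma flowC C y : flow bi ai mu C y = flow ai bi mu C y.
Proof. by rewrite /flow orbC. Qed.

Lemma in_clsC x :
  in_cls row2 row (false, false) x = in_cls row col (false, false) x.
Proof.
by rewrite /in_cls !xpair_eqE andbC /row2 odd_mod ?(negPf (grid_evenN gr2)).
Qed.

Lemma grid_corner (u : T) : exists2 x, row x = 0 & col x = 0.
Proof.
have [|w _ w0] := col_reach gr2 u (j := 0).
  exact: ltn_trans (grid_N3 gr).
have [|x rx cx] := col_reach gr w (j := 0); first exact: ltn_trans (grid_Q3 gr).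
by exists x; rewrite ?rx.
Qed.

(** * The height of one circuit along a disjoint one *)

Section Disjoint.

Variables (C1 C2 : {set T}).
Hypotheses (cC1 : circuit G C1) (cC2 : circuit G C2).
Hypothesis clC1 : forall u, u \in C1 -> in_cls row col (false, false) u.
Hypothesis clC2 : forall u, u \in C2 -> in_cls row col (false, false) u.
Hypothesis rC1 : forall u, u \in C1 -> row u != 0.
Hypothesis rC2 : forall u, u \in C2 -> row2 u != 0.
Hypothesis dC : forall u, u \in C2 -> u \notin C1.

Local Open Scope ring_scope.
Import GRing.Theory.

Let h1 := height ai bi row mu C1.
Let f2 := flow ai bi mu C2.

Let rC1' u (uC : u \in C1) : (1 <= row u <= N.-2)%N :=
  even_row_bound gr (clC1 uC) (rC1 uC).
Let N3 := grid_N3 gr.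

Let hiN : ((N.-2).+1 < N)%N. Proof. by move: N3; clear; lia. Qed.

(** A step of [C1] through [a z] or [b z] would begin or end at [z]. *)
Lemma flow_nbr z : z \in C2 ->
  flow ai bi mu C1 (a z) = 0 /\ flow ai bi mu C1 (b z) = 0.
Proof.
move=> zC; have cz := clC2 zC; have zC1 := dC zC.
rewrite (flow_a gr st clC1 cz) (flow_b gr st clC1 cz) (negPf zC1) /=.
split.
  case: andP => // -[aC /eqP e]; case/negP: zC1.
  have <- : G (a (a z)) = z by rewrite (straight_ai st (x := a (a z))) !aK.
  exact: circuit_stable.
case: andP => // -[aC /eqP e]; case/negP: zC1.
have <- : G (b (b z)) = z by rewrite (straight_bi st (x := b (b z))) !bK.
exact: circuit_stable.
Qed.

Lemma dual_ab y : in_cls row col (false, false) y ->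
  in_cls row col (dual (false, false)) (a (b y)).
Proof. by rewrite /in_cls !oddE !xpair_eqE => /andP[/eqP-> /eqP->]. Qed.

(** Both circuits are in the even class, so [C2] is pushed diagonally by [a] and [b] onto the dual
    class. The pushed step crosses only vertices next to [C2], which carry no flow of [C1], except
    at the seam, where the height jumps between [W] in the last row and 0 in row 1. *)
Lemma height_step (W : int) y :
  (forall x, in_cls row col (dual (false, false)) x -> row x = N.-1 -> h1 x = W) ->
  y \in C2 ->
  h1 (a (b (G y))) - h1 (a (b y)) =
  - (W * (if row (mu y) == N.-1 then f2 (mu y) else 0)).
Proof.
move=> hW yC; have cy := clC2 yC; have GC := circuit_stable cC2 yC.
have cG := clC2 GC; have dy := dual_ab cy; have dG := dual_ab cG.
have ry : row (a (b y)) = (row y).+1.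
  rewrite (row_a gr) (row_b gr) ifN //; apply/eqP=> e.
  have := grid_evenN gr; rewrite -e /=.
  by move/eqP: cy => [->].
have h0 x : (row x <= 1)%N -> h1 x = 0.
  exact: (height_lo gr st cC1 (ltn0Sn 0) hiN rC1').
have orow : ~~ odd (row y) by move/eqP: cy => [->].
have rN := grid_row gr y.
have rN1 : ((row y).+1 < N)%N by have := grid_row gr (a (b y)); rewrite ry.
case: (straightP st y) => -[e eG].
- have rm : row (mu y) = (row y).+1 by rewrite e (row_a gr) ifN // neq_ltn rN1.
  have fm : f2 (mu y) = 1 by rewrite /f2 /flow muK yC e aK eqxx.
  have ex : a (b (G y)) = a (a (a (b y))) by rewrite eG !(abC gr).
  rewrite fm rm ex; case: eqP => [e1|ne].
    rewrite (hW (a (b y))) ?ry // h0 ?sub0r ?mulr1 // (row_a gr).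
    rewrite (row_a gr) ry e1 (ltn_predK N3) eqxx /=.
    by case: eqP.
  have yN : ((row y).+3 < N)%N.
    have := grid_evenN gr; have [<-|] := eqVneq (row y).+3 N.
      by rewrite /= negbK (negPf orow).
    by move: ne rN1; clear; lia.
  have h := height_aa gr st clC1 dy; rewrite ry in h.
  rewrite /h1 h // [a (a (b y))](_ : _ = b (G y)); last by rewrite eG !(abC gr).
  by rewrite (flow_nbr GC).2 add0r subrr mulr0 oppr0.
- have fm : f2 (mu y) = -1 by rewrite /f2 /flow muK yC e -{1 3}(aiK y) !(nbrE gr).
  have ey : y = a (a (G y)) by rewrite eG !aiK.
  have ex : a (b y) = a (a (a (b (G y)))) by rewrite {1}ey !(abC gr).
  have rG : row (a (b (G y))) = (row (G y)).+1.
    rewrite (row_a gr) (row_b gr) ifN //; apply/eqP=> e'.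
    have := grid_evenN gr; rewrite -e' /=.
    by move/eqP: cG => [->].
  rewrite fm e (row_ai gr); have [y0|y0] := eqVneq (row y) 0%N.
    rewrite eqxx mulrN mulr1 opprK (hW (a (b (G y)))) ?h0 ?subr0 // ?ry ?y0 //.
    by rewrite rG eG !(row_ai gr) y0 /=; move: N3; clear; case: eqP; lia.
  have rGy : row (G y) = (row y).-2.
    by rewrite eG !(row_ai gr); move: y0 orow; clear; case: (row y) => [|[|k]].
  rewrite ifN; last by move: rN1; clear; lia.
  have yN : ((row (G y)).+3 < N)%N.
    by rewrite rGy; move: y0 orow rN1; clear; case: (row y) => [|[|k]] //; lia.
  have h := height_aa gr st clC1 dG; rewrite rG in h.
  rewrite /h1 ex h // [a (a (b (G y)))](_ : _ = b y); last by rewrite {2}ey !(abC gr).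
  by rewrite (flow_nbr yC).2 add0r subrr mulr0 oppr0.
- have rm : row (mu y) = row y by rewrite e (row_b gr).
  rewrite rm ifN ?mulr0 ?oppr0; last first.
    apply: contraNneq orow => ->; have := grid_evenN gr; move: N3.
    by case: (N) => //= k _; rewrite negbK.
  have ex : a (b (G y)) = b (b (a (b y))) by rewrite eG !(abC gr).
  rewrite ex /h1 (height_bb gr st cC1 clC1 (ltn0Sn 0) hiN rC1' dy).
  rewrite [b (a (b y))](_ : _ = a (G y)); last by rewrite eG !(abC gr).
  by rewrite (flow_nbr GC).1 subr0 subrr.
- have rm : row (mu y) = row y by rewrite e (row_bi gr).
  rewrite rm ifN ?mulr0 ?oppr0; last first.
    apply: contraNneq orow => ->; have := grid_evenN gr; move: N3.
    by case: (N) => //= k _; rewrite negbK.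
  have ey : y = b (b (G y)) by rewrite eG !biK.
  have ex : a (b y) = b (b (a (b (G y)))) by rewrite {1}ey !(abC gr).
  rewrite ex /h1 (height_bb gr st cC1 clC1 (ltn0Sn 0) hiN rC1' dG).
  rewrite [b (a (b (G y)))](_ : _ = a y); last by rewrite {2}ey !(abC gr).
  by rewrite (flow_nbr yC).1 subr0 subrr.
Qed.

(* Along C2 the height of C1 only changes where C2 crosses from row N - 1 to row
   0 or back, namely by -W or W. *)
Lemma flux_eq0 (W : int) : W != 0 ->
  (forall x, in_cls row col (dual (false, false)) x -> row x = N.-1 -> h1 x = W) ->
  \sum_(x | row x == N.-1) f2 x = 0.
Proof.
move=> W0 hW; pose r y := h1 (a (b y)).
(* The sum telescopes, as [G] permutes [C2]. *)
have : \sum_(y in C2) (r (G y) - r y) = 0.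
  rewrite big_split /= -(big_imset (h := G) r); last exact: circuit_inj.
  by rewrite (circuit_imset cC2) -big_split /= big1 // => y _; rewrite subrr.
rewrite (eq_bigr _ (fun y yC => height_step hW yC)) /= sumrN -mulr_sumr.
move/eqP; rewrite oppr_eq0 mulf_eq0 (negPf W0) /= => /eqP e.
rewrite -[RHS]e [RHS]big_mkcond [LHS]big_mkcond [RHS](reindex_inj (can_inj muK)) /=.
apply: eq_bigr => x _; rewrite muK; case: ifP => // _; case: ifP => // /negbT xC.
exact: flow_eq0.
Qed.

Let h2 := height bi ai row2 mu C2.

Let clC2' u : u \in C2 -> in_cls row2 row (false, false) u.
Proof. by rewrite in_clsC; exact: clC2. Qed.
Let rC2' u (uC : u \in C2) : (1 <= row2 u <= N2.-2)%N :=
  even_row_bound gr2 (clC2' uC) (rC2 uC).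
Let N23 := grid_N3 gr2.
Let hiN2 : ((N2.-2).+1 < N2)%N. Proof. by move: N23; clear; lia. Qed.

(* Each strip between two columns with [row2 x = N2.-1] carries the same flow. *)
Lemma flux_neq0 : \sum_(x | row x == N.-1) f2 x != 0.
Proof.
have [u uC] := circuit_neq0 cC2; have [x0 x0r x0c] := grid_corner u.
(* [X] has one vertex at the end of each strip of the last row. The heights of [C2] there all equal
   [V], and each is the flow through its strip. *)
pose X x := (row x == N.-1) && (row2 x == N2.-1).
have odd_pred M : (3 < M)%N -> ~~ odd M -> odd M.-1 by case: M => //= M _; rewrite negbK.
have dX x : X x -> in_cls row2 row (dual (false, false)) x.
  case/andP=> /eqP e1 /eqP e2; rewrite /in_cls e1 e2.
  by rewrite !odd_pred // ?(grid_evenN gr) ?(grid_evenN gr2).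
have hX x : X x -> (N2.-2 < row2 x)%N.
  by case/andP=> _ /eqP->; move: N23; clear; lia.
have Xx0 : X (ai (bi x0)).
  apply/andP; split; apply/eqP.
    by rewrite (row_ai gr) (row_bi gr) x0r.
  by rewrite (row_bi gr2) (row_ai gr2) /row2 x0c mod0n.
have V0 := height_neq0 gr2 straightC cC2 clC2' rC2' hiN2 (dX _ Xx0) (hX _ Xx0).
rewrite -/row2 -/h2 in V0; set V := h2 (ai (bi x0)) in V0.
have hV x : X x -> h2 x = V.
  move=> Xx; exact: (height_const gr2 straightC cC2 clC2' (ltn0Sn 0) hiN2 rC2'
    (dX _ Xx) (dX _ Xx0) (hX _ Xx) (hX _ Xx0)).
have : \sum_(x | X x) h2 x != 0.
  rewrite (eq_bigr _ hV) sumr_const -mulr_natr mulf_neq0 //; first exact/eqP.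
  by rewrite Num.Theory.pnatr_eq0 -lt0n; apply/card_gt0P; exists (ai (bi x0)).
apply: contra => /eqP S0; apply/eqP.
pose F j := \sum_(x | (row x == N.-1) && (row2 x == j)) f2 x.
have eS : \sum_(x | row x == N.-1) f2 x = \sum_(j < N2) F j.
  by rewrite (partition_big (fun x => Ordinal (grid_row gr2 x)) predT).
(* The end vertices themselves carry no flow, so the strips account for the whole row. *)
have FN : F N2.-1 = 0.
  rewrite /F big1 // => x /andP[_ /eqP e]; rewrite /f2 -flowC.
  apply: (flow_out gr2 straightC cC2 (ltn0Sn 0) hiN2 rC2').
  by rewrite -/row2 e; move: N23; clear; lia.
have -> : \sum_(x | X x) h2 x = \sum_(k < N2.-1) \sum_(x | X x) f2 (iter k.+1 bi x).
  rewrite exchange_big; apply: eq_bigr => x /andP[_ /eqP e].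
  by rewrite /h2 /height e; apply: eq_bigr => k _; rewrite flowC.
have -> : \sum_(k < N2.-1) \sum_(x | X x) f2 (iter k.+1 bi x) =
    \sum_(k < N2.-1) F (N2.-1 - k.+1)%N.
  apply: eq_bigr => k _; rewrite /F.
  have kN : (k.+1 <= N2.-1)%N by exact: ltn_ord.
  have ib : cancel (iter k.+1 b) (iter k.+1 bi).
    by move=> x; elim: k.+1 => // j IH; rewrite iterSr /= bK.
  rewrite (reindex_inj (can_inj ib)); apply: eq_big => y; last by rewrite ib.
  have -> : X (iter k.+1 b y) = (row y == N.-1) && (row2 (iter k.+1 b y) == N2.-1).
    by rewrite /X; congr ((_ == _) && _); elim: k.+1 => // j IH; rewrite iterS (row_b gr).
  congr andb; apply/eqP/eqP => e.
    have [|e' _] := @iter_ai_coord _ _ _ _ _ _ _ _ _ gr2 k.+1 (iter k.+1 b y).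
      by rewrite e.
    by rewrite ib e in e'.
  have [|-> _] := @iter_a_coord _ _ _ _ _ _ _ _ _ gr2 k.+1 y.
    by rewrite e; move: kN N23; clear; lia.
  by rewrite e subnK.
have eN : N2 = (N2.-1).+1 by rewrite prednK ?(ltn_trans _ N23).
have : \sum_(k < N2.-1) F k = 0.
  by rewrite -[RHS]S0 eS [in RHS]eN big_ord_recr /= FN addr0.
by move=> e; rewrite -[RHS]e [RHS](reindex_inj rev_ord_inj).
Qed.

End Disjoint.

(** Circuits that meet are equal, but [C2] winds around vertically and so meets row 0, which [C1]
    avoids. If they are disjoint, the flow of [C2] through the last row is both zero and nonzero. *)
Lemma circuits_cross C1 C2 : circuit G C1 -> circuit G C2 ->
  (forall u, u \in C1 -> in_cls row col (false, false) u) ->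
  (forall u, u \in C2 -> in_cls row col (false, false) u) ->
  (forall u, u \in C1 -> row u != 0) -> (forall u, u \in C2 -> row2 u != 0) ->
  False.
Proof.
move=> cC1 cC2 clC1 clC2 rC1 rC2; have N3 := grid_N3 gr.
have [u0 _] := circuit_neq0 cC1; have [x0 x0r x0c] := grid_corner u0.
have cx0 : in_cls row col (false, false) x0 by rewrite /in_cls x0r x0c.
have [/exists_inP[u u2 u1]|] := boolP [exists u in C2, u \in C1].
  have e := circuit_meet cC1 cC2 u1 u2.
  have clC2' v : v \in C2 -> in_cls row2 row (false, false) v.
    by rewrite in_clsC; exact: clC2.
  rewrite -in_clsC in cx0.
  have [y yC y0] := circuit_meets_col gr2 straightC cC2 clC2' rC2 cx0.
  by have := rC1 y; rewrite e y0 x0r => /(_ yC).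
rewrite negb_exists_in => /forall_inP dC.
have rC1' u (uC : u \in C1) : 1 <= row u <= N.-2.
  exact: (even_row_bound gr (clC1 _ uC) (rC1 _ uC)).
have hiN : (N.-2).+1 < N by move: N3; clear; lia.
pose x1 := ai (bi x0).
have dx1 : in_cls row col (dual (false, false)) x1 by rewrite /in_cls !oddE x0r x0c.
have rx1 : row x1 = N.-1 by rewrite (row_ai gr) (row_bi gr) x0r.
have hN x : row x = N.-1 -> N.-2 < row x by move=> ->; move: N3; clear; lia.
have W0 := height_neq0 gr st cC1 clC1 rC1' hiN dx1 (hN _ rx1).
have := flux_neq0 cC2 clC2 rC2; set W := height ai bi row mu C1 x1 in W0.
rewrite (flux_eq0 cC1 cC2 clC1 clC2 rC1 dC (W := W)) ?eqxx //.
  exact/eqP.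
move=> x dx rx.
exact: (height_const gr st cC1 clC1 (ltn0Sn 0) hiN rC1' dx dx1 (hN _ rx) (hN _ rx1)).
Qed.

Variable adj : rel T.
Hypotheses (adjC : symmetric adj) (adjI : irreflexive adj).
Hypothesis adjE : forall x y,
  adj x y = [|| y == a x, y == ai x, y == b x | y == bi x].
Hypothesis pmu : partner adj mu.

(** Apply [row_alternative] in both grids. Two circuits cross; a circuit cannot pass the lines that
    the other grid forces to be matched along themselves; and if both grids force such lines, a
    vertex in row 0 and column 0 has two partners. *)
Lemma forcing_strong (u : T) : forcing_number adj (matching mu) <= #|even_cls row col|.
Proof.
have adjE2 x y : adj x y = [|| y == b x, y == bi x, y == a x | y == ai x].
  by rewrite adjE; do 4!case: eqP.
have eE : even_cls row2 row = even_cls row col.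
  by apply/setP=> x; rewrite !inE; exact: in_clsC.
have N23 := grid_N3 gr2.
have dvd0 e x : x < e -> e %| x -> x = 0.
  by move=> xe; rewrite /dvdn modn_small // => /eqP.
have [//|[C1 [cC1 clC1 rC1]]|H1] := row_alternative gr st adjC adjI adjE pmu.
  have := row_alternative gr2 straightC adjC adjI adjE2 pmu.
  rewrite eE => -[//|[C2 [cC2 clC2 rC2]]|H2]; exfalso.
    apply: (circuits_cross cC1 cC2 clC1 _ rC1 rC2) => v /clC2.
    by rewrite in_clsC.
  apply: (circuit_cross_col gr st (e := N2) _ _ _ cC1 clC1 rC1); first exact: ltnW.
    by move=> x; exact: (row_b gr2).
  by move=> x /eqP/H2.
have := row_alternative gr2 straightC adjC adjI adjE2 pmu.
rewrite eE => -[//|[C2 [cC2 clC2 rC2]]|H2]; exfalso.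
  apply: (circuit_cross_col gr2 straightC (e := N) _ _ _ cC2 clC2 rC2).
  - exact: ltnW (grid_N3 gr).
  - by move=> x; rewrite (row_b gr).
  - by move=> x /(dvd0 _ _ (grid_row gr x)) /H1.
have [x x0 c0] := grid_corner u.
have [/eqP n1 n2 /eqP n3 /eqP n4] : [/\ a x != b x, true, a x != bi x & ai x != b x].
  by rewrite !(nbrE gr).
have n5 : ai x <> bi x by apply/eqP; rewrite (nbrE gr).
have [e1|e1] := H1 _ x0; have [|e2|e2] := H2 x; rewrite ?/row2 ?c0 ?mod0n //.
- by case: n1; rewrite -e2.
- by case: n4; rewrite -e2.
- by case: n3; rewrite -e2.
- by case: n5; rewrite -e2.
Qed.

End Crossing.

(** * The horizontal matching *)

Section LowerBound.

Variables (T : finType) (a ai b bi : T -> T) (N : nat) (row : T -> nat).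
Variables (Q : nat) (col : T -> nat) (adj : rel T).
Hypothesis gr : grid a ai b bi N row Q col.
Hypotheses (adjC : symmetric adj) (adjI : irreflexive adj).
Hypothesis adjE : forall x y,
  adj x y = [|| y == a x, y == ai x, y == b x | y == bi x].

Let aK := grid_aK gr.
Let aiK := grid_aiK gr.
Let bK := grid_bK gr.
Let biK := grid_biK gr.
Let oddE := oddE gr.

Lemma partner_straight mu : partner adj mu -> exists G, straight a ai b bi mu G.
Proof.
move=> [mK aM].
exists (fun x => if mu x == a x then a (a x) else if mu x == ai x then ai (ai x)
  else if mu x == b x then b (b x) else bi (bi x)).
split=> // x; try (by move=> ->; rewrite ?eqxx ?(nbrE gr)).
by have := aM x; rewrite adjE => /or4P[]/eqP; [constructor 1 | constructor 2
  | constructor 3 | constructor 4].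
Qed.

Definition hmate x := if odd (col x) then bi x else b x.

Lemma hmate_partner : partner adj hmate.
Proof.
split=> x; rewrite /hmate; last by case: ifP; rewrite adjE eqxx ?orbT.
by case ox: (odd (col x)); rewrite oddE ox /= ?bK ?biK.
Qed.

Let hmateK : involutive hmate := hmate_partner.1.

(** * Forcing sets of the horizontal matching *)

Section Forcing.

Variable S : {set {set T}}.
Hypothesis fS : forcing_set adj (matching hmate) S.

(** Every edge of the horizontal matching is represented by its left end, which is in [EC]. *)
Let EC := [set x | ~~ odd (col x)].
Let U := [set x in EC | [set x; hmate x] \in S].

Lemma card_even_col : #|EC| = 2 * #|even_cls row col|.
Proof.
have [G st] := partner_straight hmate_partner.
rewrite -(card_matching_even gr st hmate_partner).
have nE x : x \in EC -> hmate x \notin EC.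
  by rewrite !inE /hmate => /negPf ox; rewrite ox oddE ox.
rewrite -(card_edges hmate_partner nE); congr #|pred_of_set _|.
apply/setP=> E; apply/imsetP/imsetP=> -[x xE ->]; first by exists x.
have [ox|ox] := boolP (odd (col x)); last by exists x; rewrite ?inE.
by exists (hmate x); rewrite ?hmateK 1?setUC // inE /hmate ox oddE ox.
Qed.

Lemma card_forcing_even_col : #|U| = #|S|.
Proof.
have nU x : x \in U -> hmate x \notin U.
  by rewrite !inE /hmate => /andP[/negPf ox _]; rewrite ox oddE ox.
rewrite -(card_edges hmate_partner nU); congr #|pred_of_set _|.
apply/setP=> E; apply/imsetP/idP=> [[x /[!inE] /andP[_ +] ->] //|ES].
have /andP[/subsetP/(_ _ ES)/imsetP[x _ eE] _] := fS.
have [ox|ox] := boolP (odd (col x)); last by exists x; rewrite ?inE ?ox -?eE.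
have e : E = [set hmate x; hmate (hmate x)] by rewrite hmateK setUC.
by exists (hmate x); rewrite // !inE -e ES /hmate ox oddE ox.
Qed.

(* Otherwise the square x, b x, a x, a (b x) can be rotated. *)
Lemma square_forcing x : x \in EC -> x \notin U -> a x \in U.
Proof.
move=> xE xU; apply/negPn/negP=> axU.
have ox : odd (col x) = false by move: xE; rewrite inE => /negPf.
pose nu v := if odd (row v) == odd (row x) then a v else ai v.
have pnu : partner adj nu.
  split=> v; rewrite /nu; last by case: ifP; rewrite adjE eqxx ?orbT.
  case ov: (odd (row v) == odd (row x)); rewrite oddE ?aK ?aiK;
    by move: ov; do 2!case: odd.
have xS : [set x; b x] \notin S.
  by move: xU; rewrite !inE ox /= /hmate ox.
have axS : [set a x; a (b x)] \notin S.
  by move: axU; rewrite !inE oddE ox /= /hmate oddE ox -(abC gr).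
pose Z := [set x; b x; a x; a (b x)].
have h1 : hmate x = b x by rewrite /hmate ox.
have h2 : hmate (b x) = x by rewrite -h1 hmateK.
have h3 : hmate (a x) = a (b x) by rewrite /hmate oddE ox (abC gr).
have h4 : hmate (a (b x)) = a x by rewrite -h3 hmateK.
have inZ v : v \in Z = [|| v == x, v == b x, v == a x | v == a (b x)].
  by rewrite !inE -!orbA.
suff : ~~ forcing_set adj (matching hmate) S by rewrite fS.
apply: (not_forcing (Z := Z) (z := x) adjI hmate_partner pnu).
- by move=> v; rewrite !inZ => /or4P[]/eqP->; rewrite ?h1 ?h2 ?h3 ?h4 eqxx ?orbT.
- by move=> v; rewrite !inZ => /or4P[]/eqP->; rewrite /nu ?oddE;
    case: odd; rewrite /= ?aK ?eqxx ?orbT.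
- by rewrite inZ eqxx.
- by rewrite /nu eqxx h1 (nbrE gr).
- by move=> v; rewrite !inZ => /or4P[]/eqP->;
    rewrite ?h1 ?h2 ?h3 ?h4 // setUC.
Qed.

Lemma card_forcing : #|even_cls row col| <= #|S|.
Proof.
have sU : [set a x | x in EC :\: U] \subset U.
  by apply/subsetP=> _ /imsetP[x /setDP[xE xU] ->]; exact: square_forcing.
have := subset_leq_card sU; rewrite card_imset; last exact: can_inj aK.
have UE : U \subset EC by apply/subsetP=> x; rewrite inE => /andP[].
by rewrite cardsD (setIidPr UE) card_even_col card_forcing_even_col; clear; lia.
Qed.

(* If S is that small, membership in U alternates along the orbits of a, so
   that some row avoids S altogether and can be rotated. *)
Lemma card_forcing_orbit :
  0 < #|even_cls row col| ->
  (forall x y, odd (col x) = odd (col y) -> exists k, y = iter k a x) ->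
  #|even_cls row col| < #|S|.
Proof.
move=> W0 orb; rewrite ltn_neqAle card_forcing andbT; apply/eqP=> eS.
have UE : U \subset EC by apply/subsetP=> x; rewrite inE => /andP[].
have cU' : #|EC :\: U| = #|U|.
  by rewrite cardsD (setIidPr UE) card_even_col card_forcing_even_col -eS; clear; lia.
have aU : [set a x | x in EC :\: U] = U.
  apply/eqP; rewrite eqEcard card_imset ?cU' ?leqnn ?andbT; last exact: can_inj aK.
  by apply/subsetP=> _ /imsetP[x /setDP[xE xU] ->]; exact: square_forcing.
have alt x : x \in EC -> (a x \in U) = (x \notin U).
  move=> xE; rewrite -{1}aU mem_imset; last exact: can_inj aK.
  by rewrite in_setD xE andbT.
have [x0] : exists x, x \in EC :\: U.
  by apply/card_gt0P; rewrite cU' card_forcing_even_col -eS.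
case/setDP=> x0E x0U.
(* Such a vertex is some iterate of [a] at [x0]; returning to the same row takes an even number of
   steps because [N] is even. *)
have evx v : row v = row x0 -> ~~ odd (col v) -> v \notin U.
  move=> rv cv; have [|k ek] := orb x0 v.
    by move: x0E; rewrite inE => /negPf->; rewrite (negPf cv).
  have it j : iter j a x0 \in EC /\ (iter j a x0 \in U) = odd j /\
      odd (row (iter j a x0)) = odd j (+) odd (row x0).
    elim: j => [|j [jE [jU jr]]] /=; first by rewrite x0E (negPf x0U).
    split; first by move: jE; rewrite !inE oddE.
    by split; [rewrite alt // jU | rewrite oddE jr addNb].
  have [_ [vU vr]] := it k; rewrite -ek in vU vr; rewrite vU.
  by move: vr; rewrite rv; case: odd; case: odd.
pose nu v := if odd (col v) then b v else bi v.
have pnu : partner adj nu.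
  split=> v; rewrite /nu; last by case: ifP; rewrite adjE eqxx ?orbT.
  by case ov: (odd (col v)); rewrite oddE ov /= ?bK ?biK.
have ox0 : odd (col x0) = false by move: x0E; rewrite inE => /negPf.
suff : ~~ forcing_set adj (matching hmate) S by rewrite fS.
apply: (not_forcing (Z := [set v | row v == row x0]) (z := x0) adjI hmate_partner pnu).
- by move=> v; rewrite !inE /hmate; case: ifP; rewrite oddE.
- by move=> v; rewrite !inE /nu; case: ifP; rewrite oddE.
- by rewrite inE.
- by rewrite /nu /hmate ox0 (nbrE gr).
move=> v; rewrite inE => /eqP rv; have [ov|ov] := boolP (odd (col v)).
  have := evx (hmate v); rewrite !inE /hmate ov !oddE ov rv /= => /(_ erefl isT).
  by rewrite biK setUC.
by have := evx v rv ov; rewrite !inE ov.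
Qed.

End Forcing.

Lemma max_forcing_ge : #|even_cls row col| <= max_forcing_number adj.
Proof.
have pM := pm_matching hmate_partner.
apply: leq_trans (leq_bigmax_cond _ pM).
by have [S fS ->] := forcing_number_attained pM; exact: card_forcing.
Qed.

Lemma max_forcing_gt : 0 < #|even_cls row col| ->
  (forall x y, odd (col x) = odd (col y) -> exists k, y = iter k a x) ->
  #|even_cls row col| < max_forcing_number adj.
Proof.
have pM := pm_matching hmate_partner.
move=> W0 orb; apply: leq_trans (leq_bigmax_cond _ pM).
by have [S fS ->] := forcing_number_attained pM; exact: card_forcing_orbit.
Qed.

Lemma max_forcing_weak :
  (forall x y, row x = row y -> col x = col y -> x = y) ->
  max_forcing_number adj <= #|even_cls row col|.+1.
Proof.
move=> inj; apply/bigmax_leqP=> M /(pm_partner adjC adjI)[mu pmu ->].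
have [G st] := partner_straight pmu.
exact: (forcing_weak gr st adjC adjI adjE pmu inj).
Qed.

Lemma max_forcing_strong N2 (u : T) :
  grid b bi a ai N2 (fun x => col x %% N2) N row ->
  max_forcing_number adj <= #|even_cls row col|.
Proof.
move=> gr2; apply/bigmax_leqP=> M /(pm_partner adjC adjI)[mu pmu ->].
have [G st] := partner_straight pmu.
exact: (forcing_strong gr st gr2 adjC adjI adjE pmu u).
Qed.

End LowerBound.

(** * The torus *)

Section TorusGrid.

Variables p q s : nat.
Hypotheses (p3 : 3 < p) (q3 : 3 < q) (sq : s <= q).
Hypotheses (evp : ~~ odd p) (evq : ~~ odd q) (evs : ~~ odd s).

Let p0 : 0 < p. Proof. exact: ltn_trans p3. Qed.
Let q0 : 0 < q. Proof. exact: ltn_trans q3. Qed.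

Let T : finType := torus_vertex p q.

Definition modord_row k : 'I_p := Ordinal (ltn_pmod k p0).
Definition modord_col k : 'I_q := Ordinal (ltn_pmod k q0).

Definition down (x : T) : T :=
  if x.1.+1 == p then (modord_row 0, modord_col (x.2 + s))
  else (modord_row x.1.+1, x.2).
(** Here [q - s], and [q.-1] in [left], stand for [- s] and [- 1] modulo [q]. *)
Definition up (x : T) : T :=
  if x.1 == 0 :> nat then (modord_row p.-1, modord_col (x.2 + (q - s)))
  else (modord_row x.1.-1, x.2).
Definition right (x : T) : T := (x.1, modord_col (x.2 + 1)).
Definition left (x : T) : T := (x.1, modord_col (x.2 + q.-1)).

Definition trow (x : T) : nat := x.1.
Definition tcol (x : T) : nat := x.2.

Lemma coord_inj x y : trow x = trow y -> tcol x = tcol y -> x = y.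
Proof. by case: x y => [i j] [k l] /val_inj /= -> /val_inj /= ->. Qed.

Lemma trow_down x : trow (down x) = if (trow x).+1 == p then 0 else (trow x).+1.
Proof.
rewrite /trow /down; case: eqP => [_|ne] /=; first exact: mod0n.
by rewrite modn_small // ltn_neqAle; apply/andP; split; [exact/eqP | exact: ltn_ord].
Qed.

Lemma trow_up x : trow (up x) = if trow x == 0 then p.-1 else (trow x).-1.
Proof.
rewrite /trow /up; case: eqP => [_|ne] /=; rewrite modn_small //.
  by rewrite ltn_predL.
exact: leq_ltn_trans (leq_pred _) (ltn_ord _).
Qed.

Lemma tcol_down x :
  tcol (down x) = if (trow x).+1 == p then (tcol x + s) %% q else tcol x.
Proof. by rewrite /tcol /trow /down; case: eqP. Qed.

Lemma tcol_up x :
  tcol (up x) = if trow x == 0 then (tcol x + (q - s)) %% q else tcol x.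
Proof. by rewrite /tcol /trow /up; case: eqP. Qed.

Lemma tcol_lt x : tcol x < q. Proof. exact: ltn_ord. Qed.
Lemma trow_lt x : trow x < p. Proof. exact: ltn_ord. Qed.

Lemma succ_mod e j : 0 < e -> (j + 1) %% e = if (j %% e).+1 == e then 0 else (j %% e).+1.
Proof.
move=> e0; rewrite addn1 -addn1 -modnDml addn1; have := ltn_pmod j e0.
by case: eqP => [->|ne jN]; rewrite ?modnn // modn_small //; move: ne jN; clear; lia.
Qed.

Lemma downK : cancel down up.
Proof.
move=> x; apply: coord_inj.
  by rewrite trow_up trow_down; case: ((trow x).+1 =P p) => //= <-.
rewrite tcol_up trow_down tcol_down; case: ((trow x).+1 =P p) => //= _.
by rewrite modnDml -addnA subnKC // modnDr modn_small ?tcol_lt.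
Qed.

Lemma upK : cancel up down.
Proof.
move=> x; have [x0|x0] := eqVneq (trow x) 0; apply: coord_inj.
- by rewrite trow_down trow_up x0 eqxx prednK // eqxx.
- rewrite tcol_down trow_up tcol_up x0 eqxx prednK // eqxx modnDml -addnA.
  by rewrite subnK // modnDr modn_small ?tcol_lt.
- rewrite trow_down trow_up (negPf x0) prednK ?lt0n // ifN //.
  by rewrite neq_ltn trow_lt.
rewrite tcol_down trow_up tcol_up (negPf x0) prednK ?lt0n // ifN //.
by rewrite neq_ltn trow_lt.
Qed.

Lemma rightK : cancel right left.
Proof.
move=> x; apply: coord_inj => //; rewrite /tcol /= modnDml -addnA add1n prednK //.
by rewrite modnDr modn_small.
Qed.

Lemma leftK : cancel left right.
Proof.
move=> x; apply: coord_inj => //; rewrite /tcol /= modnDml -addnA addn1 prednK //.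
by rewrite modnDr modn_small.
Qed.

Lemma down_right x : down (right x) = right (down x).
Proof.
rewrite /down /=; case: ifP => _; apply: coord_inj => //.
by rewrite /tcol /= !modnDml addnAC.
Qed.

Lemma iter_right k x : iter k right x = (x.1, modord_col (x.2 + k)).
Proof.
elim: k => [|k IH] /=; last first.
  rewrite IH /right /=; apply: coord_inj => //.
  by rewrite /tcol /= modnDml -addnA addn1.
by apply: coord_inj => //; rewrite /tcol /= addn0 modn_small.
Qed.

Lemma torus_grid : grid down up right left p trow q tcol.
Proof.
split=> //.
- exact: downK.
- exact: upK.
- exact: rightK.
- exact: leftK.
- exact: down_right.
- exact: trow_lt.
- exact: trow_down.
- exact: tcol_lt.
- by move=> x; rewrite {1}/tcol /= succ_mod // modn_small.
- by move=> x xp; rewrite tcol_down ifN // neq_ltn xp.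
- move=> x; rewrite tcol_down; case: ifP => // _.
  by rewrite odd_mod ?(negPf evq) // oddD (negPf evs) addbF.
move=> x y e; exists (tcol y + q - tcol x); rewrite iter_right.
apply: coord_inj => //; rewrite /tcol /= subnKC ?modnDr ?modn_small //.
by rewrite (leq_trans (ltnW (ltn_ord x.2))) // leq_addl.
Qed.

Let e := gcdn s q.

Lemma tcol_down_mod x : tcol (down x) = tcol x %[mod e].
Proof.
rewrite tcol_down; case: ifP => // _; rewrite modn_dvdm ?dvdn_gcdr //.
by rewrite -modnDmr (eqP (dvdn_gcdl s q)) addn0.
Qed.

Lemma down_reach_row x i : trow x <= i < p ->
  exists2 k, trow (iter k down x) = i & tcol (iter k down x) = tcol x.
Proof.
case/andP=> xi ip; exists (i - trow x).
  by have [|-> _] := iter_a_coord torus_grid (j := i - trow x) (x := x); rewrite subnKC.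
by have [|_ ->] := iter_a_coord torus_grid (j := i - trow x) (x := x); rewrite ?subnKC.
Qed.

(** Crossing the seam [t.+1] times shifts the column by [t.+1 * s]; the row reached in the end is
    arbitrary. *)
Lemma down_turn x t i : i < p -> exists k,
  trow (iter k down x) = i /\ tcol (iter k down x) = (tcol x + t.+1 * s) %% q.
Proof.
have step z l : l < p -> exists k,
    trow (iter k down z) = l /\ tcol (iter k down z) = (tcol z + s) %% q.
  move=> lp; have [|k1 r1 c1] := @down_reach_row z p.-1.
    by have := trow_lt z; move: p0; clear; lia.
  have [|k2 r2 c2] := @down_reach_row (iter k1.+1 down z) l.
    by rewrite /= trow_down r1 prednK // eqxx lp.
  exists (k2 + k1.+1); rewrite iterD r2 c2; split=> //=.
  by rewrite tcol_down r1 prednK // eqxx c1.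
move=> ip; elim: t => [|t [k [rk ck]]]; first by rewrite mul1n; exact: step.
have [k2 [r2 c2]] := step (iter k down x) _ ip.
exists (k2 + k); rewrite iterD r2 c2 ck; split=> //.
by rewrite modnDml [in RHS]mulSn -addnA [_ * s + s]addnC.
Qed.

(** By Bezout, the multiples of [s] modulo [q] are those of [e]. *)
Lemma down_orbit x y : 0 < s -> tcol x = tcol y %[mod e] -> exists k, y = iter k down x.
Proof.
move=> s0 exy; have x2 := tcol_lt x; have y2 := tcol_lt y.
have xq : tcol x <= tcol y + q by rewrite (leq_trans (ltnW x2)) ?leq_addl.
have /dvdnP[c ec] : e %| tcol y + q - tcol x.
  rewrite -eqn_mod_dvd // -modnDmr (eqP (dvdn_gcdr s q)) addn0; exact/eqP.
have [km kn ek _] := egcdnP q s0.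
(* The extra [q] turns leave the column unchanged and make the number of turns positive. *)
have [k [rk ck]] := @down_turn x (km * c + q).-1 _ (trow_lt y).
exists k; apply: coord_inj => //; rewrite ck prednK; last by rewrite addn_gt0 q0 orbT.
rewrite mulnDl mulnAC ek mulnDl -/e [e * c]mulnC -ec.
have -> : tcol x + (kn * q * c + (tcol y + q - tcol x) + q * s) =
    (kn * c + s + 1) * q + tcol y.
  by rewrite !mulnDl mul1n [kn * c * q]mulnAC [s * q]mulnC; move: xq; clear; lia.
by rewrite modnMDl modn_small.
Qed.

Lemma torus_gridC : ~~ odd e -> 3 < e -> 0 < s ->
  grid right left down up e (fun x => tcol x %% e) p trow.
Proof.
move=> eve e3 s0; have e0 : 0 < e by exact: ltn_trans e3.
split=> //.
- exact: rightK.
- exact: leftK.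
- exact: downK.
- exact: upK.
- by move=> x; rewrite down_right.
- by move=> x; rewrite ltn_pmod.
- by move=> x; rewrite {1}/tcol /= modn_dvdm ?dvdn_gcdr // succ_mod.
- exact: tcol_down_mod.
- exact: trow_lt.
- exact: trow_down.
by move=> x y exy; exact: down_orbit.
Qed.

Lemma torus_adjE x y : torus_adj p q s x y =
  [|| y == down x, y == up x, y == right x | y == left x].
Proof.
have pairE (u v : T) : (u == v) = (trow u == trow v) && (tcol u == tcol v).
  apply/eqP/andP=> [->|[/eqP e1 /eqP e2]]; first by rewrite !eqxx.
  exact: coord_inj.
have R (u v : T) : (u.1 == v.1) && (v.2 == u.2 + 1 %[mod q]) = (v == right u).
  rewrite pairE eq_sym; congr andb.
  by rewrite {2}/tcol /= [v.2 %% q]modn_small.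
have D (u v : T) : (v.1 == u.1.+1 :> nat) && (u.2 == v.2) ||
    [&& v.1 == 0 :> nat, u.1 == p.-1 :> nat & v.2 == u.2 + s %[mod q]] =
    (v == down u).
  rewrite pairE trow_down tcol_down /trow -/(tcol u) -/(tcol v).
  have -> : (u.1 == p.-1 :> nat) = (u.1.+1 == p).
    by rewrite -[X in _ = (_ == X)](prednK p0) eqSS.
  rewrite [v.2 %% q]modn_small //.
  case: ifP => [/eqP up1|_]; last by rewrite andbF orbF [u.2 == _]eq_sym.
  rewrite up1; have -> : (v.1 == p :> nat) = false by rewrite ltn_eqF.
  by [].
have -> : torus_adj p q s x y =
  [|| (y == down x), (x == down y), (y == right x) | (x == right y)].
  have orb6 r1 a1 b1 r2 a2 b2 : [|| r1, a1 | b1] || [|| r2, a2 | b2] =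
      [|| a1 || b2, a2 || b1, r1 | r2].
    by case: r1; case: a1; case: b1; case: r2; case: a2; case: b2.
  by rewrite /torus_adj /torus_edge (R x y) (R y x) orb6 (D x y) (D y x).
have -> : (x == down y) = (y == up x) by rewrite -{1}(upK x) (can_eq downK) eq_sym.
have -> : (x == right y) = (y == left x); last by [].
by rewrite -{1}(leftK x) (can_eq rightK) eq_sym.
Qed.

End TorusGrid.

Lemma card_even_torus n m (p3 : 3 < 2 * n) (q3 : 3 < 2 * m) :
  #|even_cls (@trow (2 * n) (2 * m)) (@tcol (2 * n) (2 * m))| = m * n.
Proof.
pose f (z : 'I_n * 'I_m) : torus_vertex (2 * n) (2 * m) :=
  (modord_row p3 (2 * z.1), modord_col q3 (2 * z.2)).
have lt2 k (i : 'I_k) : 2 * i < 2 * k by rewrite ltn_pmul2l.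
have fI : injective f.
  move=> [i j] [k l] /(congr1 (fun z => (val z.1, val z.2))) [].
  rewrite /= !modn_small ?lt2 // => /eqP e1 /eqP e2.
  by rewrite !eqn_pmul2l // in e1 e2; congr pair; apply/val_inj/eqP.
have -> : even_cls (@trow (2 * n) (2 * m)) (@tcol (2 * n) (2 * m)) =
  [set f z | z : 'I_n * 'I_m].
  apply/setP=> x; apply/idP/imsetP=> [|[z _ ->]]; last first.
    by rewrite inE /trow /tcol /= !modn_small ?lt2 // !mul2n !odd_double.
  rewrite inE => /eqP[e1 e2].
  have h k (i : 'I_(2 * k)) : odd i = false -> i./2 < k /\ 2 * i./2 = i.
    move=> oi; have := odd_double_half i; rewrite oi add0n -mul2n => e.
    by split=> //; rewrite -(ltn_pmul2l (m := 2)) // e ltn_ord.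
  have [h1 h1'] := h _ _ e1; have [h2 h2'] := h _ _ e2.
  exists (Ordinal h1, Ordinal h2) => //.
  by apply: coord_inj; rewrite /trow /tcol /= modn_small ?lt2 ?h1' ?h2' // ltn_ord.
by rewrite card_imset // card_prod !card_ord mulnC.
Qed.

Theorem theorem4p2 (n m r : nat) (hn : 2 <= n) (hm : 2 <= m)
    (hr : 1 <= r <= m) :
  max_forcing_number (torus_adj (2 * n) (2 * m) (2 * r)) =
    if coprime r m then m * n + 1 else m * n.
Proof.
have ev k : ~~ odd (2 * k) by rewrite mul2n odd_double.
have [r1 rm] := andP hr.
have p3 : 3 < 2 * n by exact: (leq_mul (leqnn 2) hn).
have q3 : 3 < 2 * m by exact: (leq_mul (leqnn 2) hm).
have sq : 2 * r <= 2 * m by rewrite leq_mul2l.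
have s0 : 0 < 2 * r by rewrite muln_gt0.
have gr := torus_grid p3 q3 sq (ev n) (ev m) (ev r).
have adjE := torus_adjE p3 q3 sq.
have adjC := @torus_adj_sym (2 * n) (2 * m) (2 * r).
have adjI : irreflexive (torus_adj (2 * n) (2 * m) (2 * r)).
  by apply: torus_adj_irrefl; [exact: ltnW (ltnW p3) | exact: ltnW].
have cE := card_even_torus p3 q3.
have mn0 : 0 < m * n by rewrite muln_gt0 (ltnW hm) (ltnW hn).
have [co|nco] := boolP (coprime r m); apply/eqP; rewrite eqn_leq ?addn1 -cE.
  rewrite (max_forcing_weak gr adjC adjI adjE (@coord_inj _ _)) /=.
  apply: (max_forcing_gt gr adjI adjE); first by rewrite cE.
  move=> x y oxy; apply: down_orbit => //.
  (* The gcd of [2 * r] and [2 * m] is 2 here, so the orbits of [down] are the two column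
     parities. *)
  rewrite -muln_gcdr (eqP co) muln1 !modn2; congr nat_of_bool; exact: oxy.
rewrite (max_forcing_ge gr adjI adjE) andbT.
apply: (max_forcing_strong gr adjC adjI adjE (modord_row p3 0, modord_col q3 0)).
(* Now the gcd of [2 * r] and [2 * m] is even and at least 4, as the second grid requires. *)
have g1 : 1 < gcdn r m by rewrite ltn_neqAle eq_sym gcdn_gt0 r1 andbT.
apply: torus_gridC => //; rewrite -muln_gcdr; first exact: ev.
exact: (leq_mul (leqnn 2) g1).
Qed.
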